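(* Let $n\ge1$, $\delta>0$ and $n<\beta<n+2$. Let $\mathbf b\in\mathcal H^S(\mathbf T^n)$ with $S\ge0$, and suppose that there exists a nonnegative integer $p$ such that $$S>n+(p-2)\frac{\beta-n}{2}.$$ Let $$\mathbf u(x,t)=\widehat{\mathbf b}_0\frac{t^2}{2}+\sum_{0\ne k\in\mathbb{Z}^n}\left[\cos(\sqrt{-M_k}\,t)-I\right]M_k^{-1}\widehat{\mathbf b}_ke^{ik\cdot x}$$ for $x\in\mathbf T^n$, $t\ge0$. Then $\mathbf u(x,\cdot)\in C^p[0,\infty)$ (in the classical sense) for any $x\in\mathbf T^n$.
   Context: Torus and spaces: $\mathbf T^n=\prod_{i=1}^n[0,2\pi]$ with periodic identification; a periodic vector distribution $\mathbf g$ is written $\mathbf g=\sum_{k\in\mathbb{Z}^n}\widehat{\mathbf g}_k e^{ik\cdot x}$ with Fourier coefficients $\widehat{\mathbf g}_k\in\mathbb{C}^n$. For $q\in\mathbb{R}$, $\mathcal H^q(\mathbf T^n)$ is the space of periodic vector distributions with $\|\mathbf g\|^2_{\mathcal H^q}=\sum_k(1+\|k\|^2)^q\|\widehat{\mathbf g}_k\|^2<\infty$. Multipliers: with ${}_pF_q(a_1,\dots,a_p;b_1,\dots,b_q;x)=\sum_{m\ge0}\frac{(a_1)_m\cdots(a_p)_m}{(b_1)_m\cdots(b_q)_m}\frac{x^m}{m!}$, where $(a)_m=a(a+1)\cdots(a+m-1)$, set for $\nu\in\mathbb{R}^n$ $$\lambda_1(\nu)=-\|\nu\|^2\Big(3\mu\,{}_3F_4\big(1,\tfrac52,\tfrac{n+2-\beta}{2};2,\tfrac32,\tfrac{n+4}{2},\tfrac{n+4-\beta}{2};-\tfrac14\|\nu\|^2\delta^2\big)+(\lambda^*-\mu)\,{}_1F_2\big(\tfrac{n+2-\beta}{2};\tfrac{n+2}{2},\tfrac{n+4-\beta}{2};-\tfrac14\|\nu\|^2\delta^2\big)^2\Big),$$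 $$\lambda_2(\nu)=-\mu\|\nu\|^2\,{}_2F_3\big(1,\tfrac{n+2-\beta}{2};2,\tfrac{n+4}{2},\tfrac{n+4-\beta}{2};-\tfrac14\|\nu\|^2\delta^2\big).$$ For $k\in\mathbb{Z}^n\setminus\{0\}$, $M_k$ is the real symmetric $n\times n$ matrix with $M_kk=\lambda_1(k)k$ and $M_kw=\lambda_2(k)w$ for $w\perp k$ (the Fourier multiplier of the linear state-based peridynamic operator). $\sqrt{-M_k}$ and $\cos(\sqrt{-M_k}t)$ are defined by functional calculus: same eigenvectors, with eigenvalues $\sqrt{-\lambda_i(k)}$ and $\cos(\sqrt{-\lambda_i(k)}t)$. $I$ is the identity matrix. Standing assumption: the Lamé parameters satisfy $\mu>0$ and $\lambda^*\in\mathbb{R}$ is such that $\lambda_1(\nu)<0$ for all $\nu\ne0$ (and $\lambda_2(\nu)<0$ for all $\nu\neq0$). *)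

(* Defs.v *)
From HB Require Import structures.
From mathcomp Require Import all_boot all_order all_algebra.
From mathcomp Require Import finmap.
From mathcomp Require Import all_classical all_reals all_analysis.
From mathcomp Require Import complex.
From mathcomp Require summability.

Set Implicit Arguments.
Unset Strict Implicit.
Unset Printing Implicit Defensive.

Import Order.TTheory GRing.Theory Num.Theory.
Import numFieldNormedType.Exports.

Local Open Scope classical_set_scope.
Local Open Scope ring_scope.

(* [R[i]] packaged as a field, so that [Cx R] and ['cV[Cx R]_n] carry the
   norm and topology of a normed module over the complex numbers. *)
Definition Cx (R : realType) : numClosedFieldType := R[i].

Definition ofR {R : realType} (r : R) : Cx R := (r%:C)%C.

Definition expi {R : realType} (a : R) : Cx R := (cos a +i* sin a)%C.

Section Euclidean.
Context {R : realType} {n : nat}.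

Definition dotv (v w : 'cV[R]_n) : R := \sum_i v i 0 * w i 0.

(* The library norm on matrices is the sup norm. *)
Definition enorm (v : 'cV[R]_n) : R := Num.sqrt (\sum_i v i 0 ^+ 2).

Definition hnorm (c : 'cV[Cx R]_n) : R :=
  Num.sqrt (\sum_i (complex.Re (c i 0) ^+ 2 + complex.Im (c i 0) ^+ 2)).

Definition freq (k : 'cV[int]_n) : 'cV[R]_n := \col_i (k i 0)%:~R.

(* The fundamental cell.  The exponentials with integer frequencies agree at
   identified points, so no quotient is formed. *)
Definition torus : set 'cV[R]_n :=
  [set x | forall i, 0 <= x i 0 <= 2 * pi].

End Euclidean.

(* A periodic distribution is given by its Fourier coefficients: the families
   arising in this way are exactly those of at most polynomial growth. *)
Record periodic_distribution (R : realType) (n : nat) := PeriodicDistribution {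
  fcoef :> 'cV[int]_n -> 'cV[Cx R]_n;
  fcoef_slow : exists (A : R) (N : nat), forall k : 'cV[int]_n,
    hnorm (fcoef k) <= A * (1 + enorm (freq k : 'cV[R]_n)) ^+ N }.

Definition sobolev {R : realType} {n : nat} (q : R)
    (g : periodic_distribution R n) : Prop :=
  ((\esum_(k in [set: 'cV[int]_n])
     (((1 + enorm (freq k : 'cV[R]_n) ^+ 2) `^ q * hnorm (g k) ^+ 2)%:E))
   < +oo)%E.

Section Hypergeometric.
Context {R : realType}.

Definition pochhammer (a : R) (m : nat) : R := \prod_(i < m) (a + i%:R).

Definition hyperF (a b : seq R) (x : R) : R :=
  limn (series (fun m =>
    (\prod_(c <- a) pochhammer c m) / (\prod_(c <- b) pochhammer c m)
      * (x ^+ m / m`!%:R))).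

End Hypergeometric.

Section Multipliers.
Context {R : realType} {n : nat}.
Variables (mu lams delta beta : R).

Let N : R := n%:R.
Let arg (v : 'cV[R]_n) : R := - (4^-1) * enorm v ^+ 2 * delta ^+ 2.

Definition lambda1 (v : 'cV[R]_n) : R :=
  - enorm v ^+ 2 *
    (3 * mu * hyperF [:: 1; 5 / 2; (N + 2 - beta) / 2]
                     [:: 2; 3 / 2; (N + 4) / 2; (N + 4 - beta) / 2] (arg v)
     + (lams - mu) * hyperF [:: (N + 2 - beta) / 2]
                            [:: (N + 2) / 2; (N + 4 - beta) / 2] (arg v) ^+ 2).

Definition lambda2 (v : 'cV[R]_n) : R :=
  - mu * enorm v ^+ 2 *
    hyperF [:: 1; (N + 2 - beta) / 2]
           [:: 2; (N + 4) / 2; (N + 4 - beta) / 2] (arg v).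

Definition line_proj (v : 'cV[R]_n) : 'M[R]_n :=
  (enorm v ^+ 2)^-1 *: (v *m v^T).

(* The symmetric matrix f(M_k): eigenvalue f(lambda1 k) on the line of k and
   f(lambda2 k) on its orthogonal complement. *)
Definition mult_fun (f : R -> R) (k : 'cV[int]_n) : 'M[R]_n :=
  f (lambda1 (freq k)) *: line_proj (freq k)
  + f (lambda2 (freq k)) *: (1%:M - line_proj (freq k)).

Definition mult (k : 'cV[int]_n) : 'M[R]_n := mult_fun id k.

Definition sqrt_opp_mult (k : 'cV[int]_n) : 'M[R]_n :=
  mult_fun (fun l => Num.sqrt (- l)) k.

Definition cos_sqrt_opp_mult (t : R) (k : 'cV[int]_n) : 'M[R]_n :=
  mult_fun (fun l => cos (Num.sqrt (- l) * t)) k.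

Variable b : periodic_distribution R n.

Definition usol_term (x : 'cV[R]_n) (t : R) (k : 'cV[int]_n) : 'cV[Cx R]_n :=
  if k == 0 then 0 else
  expi (dotv (freq k) x) *:
    (map_mx ofR ((cos_sqrt_opp_mult t k - 1%:M) *m invmx (mult k)) *m b k).

(* Unordered partial sums of the series over the nonzero frequencies. *)
Definition usol_sums (x : 'cV[R]_n) (t : R) : {fset 'cV[int]_n} -> 'cV[Cx R]_n :=
  summability.partial_sum (usol_term x t).

Definition usol (x : 'cV[R]_n) (t : R) : 'cV[Cx R]_n :=
  ofR (t ^+ 2 / 2) *: b 0 + lim (usol_sums x t @ summability.totally).

End Multipliers.

Section Cp_halfline.
Context {R : realType} {V : normedModType (Cx R)}.

Definition halfline : set R := `[0, +oo[.

(* One-sided at [t = 0], two-sided at [t > 0]. *)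
Definition is_halfline_derive (f : R -> V) (t : R) (l : V) : Prop :=
  (fun s => ofR (s - t)^-1 *: (f s - f t)) @ within halfline t^' --> l.

Definition Cp_halfline (p : nat) (f : R -> V) : Prop :=
  exists d : nat -> R -> V,
    [/\ forall t, 0 <= t -> d 0%N t = f t,
        forall (j : nat) (t : R), (j < p)%N -> 0 <= t ->
          is_halfline_derive (d j) t (d j.+1 t)
      & forall j : nat, (j <= p)%N -> {within halfline, continuous (d j)}].

End Cp_halfline.

Section MultiplierFacts.
Context {R : realType} {n : nat}.
Variables (mu lams delta beta : R).
Implicit Types (f : R -> R) (k : 'cV[int]_n) (w : 'cV[R]_n).

Let l1 := @lambda1 R n mu lams delta beta.
Let l2 := @lambda2 R n mu delta beta.
Let Mf := @mult_fun R n mu lams delta beta.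

Lemma enorm2E w : enorm w ^+ 2 = \sum_i w i 0 ^+ 2.
Proof. by rewrite sqr_sqrtr // sumr_ge0 // => i _; rewrite sqr_ge0. Qed.

Lemma freq_eq0 k : (freq k == 0 :> 'cV[R]_n) = (k == 0).
Proof.
apply/eqP/eqP => [/colP e|->]; apply/colP => i; last by rewrite !mxE.
by move/eqP: (e i); rewrite !mxE intr_eq0 => /eqP.
Qed.

Lemma enorm2_eq0 w : (enorm w ^+ 2 == 0) = (w == 0).
Proof.
have w0 (i : 'I_n) : true -> 0 <= w i 0 ^+ 2 by rewrite sqr_ge0.
rewrite enorm2E (psumr_eq0 _ w0).
apply/allP/eqP => [e|-> i _]; last by rewrite /= mxE expr0n /= eqxx.
apply/colP => i; rewrite mxE; apply/eqP; rewrite -sqrf_eq0.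
exact: e (mem_index_enum i).
Qed.

Lemma line_projE v w : line_proj v *m w = (dotv v w / enorm v ^+ 2) *: v.
Proof.
rewrite /line_proj -scalemxAl -mulmxA.
have -> : v^T *m w = (dotv v w)%:M.
  rewrite [LHS]mx11_scalar mxE /dotv; congr (scalar_mx _).
  by apply: eq_bigr => i _; rewrite mxE.
by rewrite mul_mx_scalar scalerA mulrC.
Qed.

Lemma dotvv w : dotv w w = enorm w ^+ 2.
Proof. by rewrite enorm2E; apply: eq_bigr => i _; rewrite expr2. Qed.

Lemma mult_fun_sym f k : (Mf f k)^T = Mf f k.
Proof.
have e : (line_proj (freq k : 'cV[R]_n))^T = line_proj (freq k).
  by rewrite /line_proj linearZ /= trmx_mul trmxK.
rewrite /Mf /mult_fun; move: (line_proj _) e => P e.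
by rewrite linearD /= !linearZ /= linearB /= trmx1 e.
Qed.

Lemma mult_fun_freq f k : k != 0 ->
  Mf f k *m freq k = f (l1 (freq k)) *: freq k.
Proof.
rewrite -freq_eq0 -enorm2_eq0 => k0.
rewrite /Mf /mult_fun mulmxDl -!(scalemxAl (f _)) mulmxBl mul1mx line_projE dotvv.
by rewrite divff // scale1r subrr scaler0 addr0.
Qed.

Lemma mult_fun_orth f k w : dotv (freq k) w = 0 ->
  Mf f k *m w = f (l2 (freq k)) *: w.
Proof.
move=> o; rewrite /Mf /mult_fun mulmxDl -!(scalemxAl (f _)) mulmxBl mul1mx line_projE o.
by rewrite mul0r scale0r scaler0 add0r subr0.
Qed.

Lemma mult_fun_unique f k (A : 'M[R]_n) : k != 0 ->
    A *m freq k = f (l1 (freq k)) *: freq k ->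
    (forall w, dotv (freq k) w = 0 -> A *m w = f (l2 (freq k)) *: w) ->
  A = Mf f k.
Proof.
move=> k0 Ak Aw; apply/trmx_inj/row_matrixP => i; rewrite -!tr_col; congr trmx.
rewrite !colE; set e := delta_mx i 0.
have kk0 : enorm (freq k : 'cV[R]_n) ^+ 2 != 0 by rewrite enorm2_eq0 freq_eq0.
pose c := dotv (freq k) e / enorm (freq k) ^+ 2.
have eE : e = c *: freq k + (e - c *: freq k) by rewrite addrC subrK.
have o : dotv (freq k) (e - c *: freq k) = 0.
  rewrite /dotv (eq_bigr (fun j => freq k j 0 * e j 0
    - c * (freq k j 0 * freq k j 0))).
    by rewrite sumrB -mulr_sumr -/(dotv _ _) -/(dotv (freq k) _) dotvv /c divfK ?subrr.
  by move=> j _; rewrite !mxE mulrBr mulrCA.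
move: (e - _) eE o => r -> o.
by rewrite !mulmxDr -!scalemxAr Ak Aw // mult_fun_freq // mult_fun_orth.
Qed.

Lemma mult_funM f g k : k != 0 -> Mf f k *m Mf g k = Mf (fun l => f l * g l) k.
Proof.
move=> k0; apply: mult_fun_unique => // [|w o]; rewrite -(mulmxA (Mf f k)).
  by rewrite (mult_fun_freq g) // -(scalemxAr (g _)) mult_fun_freq // scalerA mulrC.
by rewrite (mult_fun_orth g) // -(scalemxAr (g _)) mult_fun_orth // scalerA mulrC.
Qed.

Lemma sqrt_opp_mult_sqr k : k != 0 ->
    l1 (freq k) < 0 -> l2 (freq k) < 0 ->
  sqrt_opp_mult mu lams delta beta k *m sqrt_opp_mult mu lams delta beta k
    = - mult mu lams delta beta k.
Proof.
move=> k0 h1 h2; rewrite [LHS]mult_funM // /mult /Mf /mult_fun.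
by rewrite -!expr2 !sqr_sqrtr ?oppr_ge0 ?ltW // !scaleNr opprD.
Qed.

Lemma mult_unitmx k : k != 0 ->
    l1 (freq k) < 0 -> l2 (freq k) < 0 ->
  mult mu lams delta beta k \in unitmx.
Proof.
move=> k0 h1 h2.
suff /mulmx1_unit[] : mult mu lams delta beta k *m Mf (fun l => l^-1) k = 1%:M by [].
rewrite [LHS]mult_funM // /Mf /mult_fun !divff ?ltr0_neq0 //.
by rewrite !scale1r addrC subrK.
Qed.

End MultiplierFacts.

(* Main.v *)
Require Import Defs.
From HB Require Import structures.
From mathcomp Require Import all_boot all_order all_algebra.
From mathcomp Require Import finmap.
From mathcomp Require Import all_classical all_reals all_analysis.
From mathcomp Require Import complex.
From mathcomp Require Import ring lra.
From mathcomp Require summability.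

Set Implicit Arguments.
Unset Strict Implicit.
Unset Printing Implicit Defensive.

Import Order.TTheory GRing.Theory Num.Theory.
Import numFieldNormedType.Exports.

Local Open Scope classical_set_scope.
Local Open Scope ring_scope.

(** On the two eigenspaces of M_k the k-th term has the amplitude
    (1 - cos (w t)) / w ^ 2 with w ^ 2 = - lambda_i k, and the j-th time
    derivative of such a function is bounded by 2 w ^ (j - 2) for all t.
    Everything rests on the size of the eigenvalues (eigenvalue_order):

      c (1 + |k|^2)^al <= - lambda_i k <= C (1 + |k|^2)^al,
      al = (beta - n) / 2.

    Given this, the j-th derivative of the k-th term is at most a constant times
    (1 + |k|^2)^(al (j - 2) / 2) |b_k|, which is at most

      (1 + |k|^2)^S |b_k|^2 + (1 + |k|^2)^(- (S - al (j - 2))).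

    The first family is summable because b lies in the Sobolev space, the second
    because S - al (j - 2) exceeds n for j <= p, and then
    (1 + |k|^2)^(-n) <= prod_i 1 / (1 + k_i^2).  Dominated summation
    (usum_dominated_cvg) yields term-by-term continuity and differentiability up
    to order p (is_derive_usum, osc_series_Cp).  The lower bound on the
    eigenvalues is what makes the orders j = 0 and j = 1 work for small S.

    Both bounds on the eigenvalues are obtained without asymptotic expansions of
    hypergeometric functions.  Put a = (n + 2 - beta) / 2, which lies strictly
    between 0 and 1, b = (n + 2) / 2, z = |nu|^2 delta^2 / 4, let h(z) be the
    Bessel-type function 0F1(; b; - z), and let q(z) = b (1 - h(z)) / z.  Let F
    and G be the averages of q(s z) and h(s z) over s in the unit interval,
    against the density a s^(a - 1): then z^a F and z^a G have the derivatives
    a z^(a - 1) q and a z^(a - 1) h.  Comparing coefficients, with F, G, q taken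
    at z,

      lambda_2 = - mu |nu|^2 F,
      lambda_1 = - |nu|^2 (mu ((3 - 2 a) F + 2 a q) + (lambda^* - mu) G^2).

    Two energy functionals of the equation z h'' + b h' + h = 0 give |h| <= 1
    (bessel_sqr_le1) and z h^2 bounded (bessel_sqr_decay).  The first makes q
    nonnegative and O(1/z), so z^a F is nondecreasing and bounded: F is exactly
    of order z^(-a).  The second makes G^2 = o(z^(-a)), so the term that carries
    lambda^* is negligible for large frequencies whatever its sign; on bounded
    ranges the assumed sign of lambda_1 and compactness suffice. *)

#[local] Existing Instance summability.totally_filter.

(** * Derivatives of real functions *)

Section RealDerivatives.
Context {R : realType}.

Lemma is_derive_continuous (f : R -> R) (x l : R) :
  is_derive x 1 f l -> {for x, continuous f}.
Proof. by case=> d _; apply/differentiable_continuous/derivable1_diffP. Qed.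

Lemma le0_derive_anti (f df : R -> R) (a x y : R) :
  (forall t, a <= t -> is_derive t 1 f (df t)) ->
  (forall t, a <= t -> df t <= 0) -> a <= x -> x <= y -> f y <= f x.
Proof.
move=> fd df0 ax xy.
have [||c] := @MVT_segment R f df x y xy.
- move=> t; rewrite in_itv /= => /andP[xt _]; apply: fd.
  by rewrite (le_trans ax) // ltW.
- apply/continuous_in_subspaceT => t; rewrite inE /= in_itv /= => /andP[xt _].
  exact: is_derive_continuous (fd t (le_trans ax xt)).
rewrite in_itv /= => /andP[xc _] fE; rewrite -subr_le0 fE.
by rewrite mulr_le0_ge0 ?subr_ge0 // df0 // (le_trans ax).
Qed.

Lemma derive_bound_lipschitz (f df : R -> R) (M s t : R) :
  (forall u : R, is_derive u 1 f (df u)) -> (forall u, `|df u| <= M) ->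
  `|f s - f t| <= M * `|s - t|.
Proof.
move=> fd fM; wlog ts : s t / t <= s.
  move=> H; have [/H //|/ltW/H] := leP t s.
  by rewrite distrC (distrC t s).
have [|c _ ->] := @MVT_segment R f df t s ts (fun u _ => fd u).
  by apply/continuous_in_subspaceT => u _; exact: is_derive_continuous (fd u).
by rewrite normrM ler_wpM2r.
Qed.

Lemma is_derive_cvgP (f : R -> R) (t l : R) :
  is_derive t 1 f l <-> h^-1 * (f (h + t) - f t) @[h --> 0^'] --> l.
Proof.
have E : (fun h => h^-1 *: ((f \o shift t) (h *: 1) - f t)) = (fun h => h^-1 * (f (h + t) - f t)).
  by apply/funext => h; rewrite /= [h *: 1]mulr1.
split=> [[fd fl]|fl].
  by move: fd; rewrite /derivable E => fd; rewrite -fl /derive E.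
apply: DeriveDef; first by rewrite /derivable E; exact: cvgP fl.
by rewrite /derive E; exact: cvg_lim fl.
Qed.

(** Two-sided differentiability gives the one-sided quotient at the end point
    of the half-line, so the real functions below are differentiated on the
    whole line. *)
Lemma cvg_diff_quotient (f : R -> R) (t l : R) :
  is_derive t 1 f l -> (s - t)^-1 * (f s - f t) @[s --> within halfline t^'] --> l.
Proof.
move=> /is_derive_cvgP/cvgrPdist_lt fl; apply/cvgrPdist_lt => e e0.
have /nbhs_ballP[d /= d0 fd] := fl e e0.
have : \forall s \near t^', `|l - (s - t)^-1 * (f s - f t)| < e.
  apply/nbhs_ballP; exists d => //= s ts st.
  have := fd (s - t); rewrite /ball /= sub0r opprB subrK; apply => //.
  by rewrite subr_eq0.
by apply: filterS => s + _.
Qed.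

End RealDerivatives.

(** * Power series dominated by the exponential series *)

Section EntireSeries.
Context {R : realType}.
Implicit Types (f g : nat -> R) (x l : R).

(** This class is stable under [pseries_diffs] and under shifting indices, and
    every member converges everywhere: all the term-by-term operations below stay
    inside it. *)
Definition exp_dominated f := exists C : R, forall m, `|f m| <= C / m`!%:R.

Definition psum f x : R := limn (pseries f x).

Lemma exp_dominated_cvg f x : exp_dominated f -> cvgn (pseries f x).
Proof.
move=> [C fC]; apply: normed_cvg.
have cvgC : cvgn (series (C *: exp_coeff `|x|)).
  by apply: is_cvg_seriesZ; exact: is_cvg_series_exp_coeff.
apply: series_le_cvg cvgC => [m|m|m] /=; first exact: normr_ge0.
  rewrite mulr_ge0 ?exp_coeff_ge0 //.
  by have := le_trans (normr_ge0 _) (fC 0%N); rewrite fact0 divr1.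
rewrite normrM normrX [leRHS](_ : _ = C / m`!%:R * `|x| ^+ m); first by rewrite ler_pM.
by rewrite [LHS](_ : _ = C * (`|x| ^+ m / m`!%:R)) // mulrA mulrAC.
Qed.

Lemma psum_cvg x f : exp_dominated f -> pseries f x @ \oo --> psum f x.
Proof. by move=> fd; exact: exp_dominated_cvg. Qed.

Lemma psumE f x l : pseries f x @ \oo --> l -> psum f x = l.
Proof. exact: cvg_lim. Qed.

Lemma exp_dominatedS f : exp_dominated f -> exp_dominated (fun m => f m.+1).
Proof.
move=> [C fC]; exists C => m; apply: le_trans (fC m.+1) _.
have C0 : 0 <= C by have := le_trans (normr_ge0 _) (fC 0%N); rewrite fact0 divr1.
rewrite ler_wpM2l // lef_pV2 ?posrE ?ltr0n ?fact_gt0 // ler_nat.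
by rewrite factS leq_pmull.
Qed.

Lemma exp_dominated_diffs f : exp_dominated f -> exp_dominated (pseries_diffs f).
Proof.
move=> [C fC]; exists C => m; rewrite /pseries_diffs normrM ger0_norm //.
have := fC m.+1; rewrite -(ler_pM2l (ltr0Sn R m)) => /le_trans; apply.
by rewrite factS natrM invfM mulrCA mulVKf ?pnatr_eq0.
Qed.

Lemma exp_dominatedM (u : nat -> R) (K : R) f :
  (forall m, `|u m| <= K) -> exp_dominated f -> exp_dominated (fun m => u m * f m).
Proof.
move=> uK [C fC]; exists (K * C) => m.
by rewrite normrM -mulrA ler_pM.
Qed.

Lemma is_derive_psum f x : exp_dominated f ->
  is_derive x 1 (psum f) (psum (pseries_diffs f) x).
Proof.
move=> fd; have dd := exp_dominated_diffs fd; have ddd := exp_dominated_diffs dd.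
apply: (@pseries_snd_diffs _ f (`|x| + 1)); try exact: exp_dominated_cvg.
by rewrite (ger0_norm (addr_ge0 _ _)) // ltrDl.
Qed.

Lemma pseries_shift f x l :
  pseries (fun m => f m.+1) x @ \oo --> l -> pseries f x @ \oo --> f 0%N + x * l.
Proof.
move=> fl; rewrite -cvg_shiftS.
rewrite [X in X @ _ --> _](_ : _ = (fun n => f 0%N + x * pseries (fun m => f m.+1) x n)).
  by apply: cvgD; [exact: cvg_cst|apply: cvgM => //; exact: cvg_cst].
apply/funext => n; rewrite /pseries /series /= big_nat_recl // expr0 mulr1.
by congr (_ + _); rewrite mulr_sumr; apply: eq_bigr => i _; rewrite exprS mulrCA.
Qed.

Lemma pseriesD f g x l l' : pseries f x @ \oo --> l -> pseries g x @ \oo --> l' ->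
  pseries (fun m => f m + g m) x @ \oo --> l + l'.
Proof.
move=> fl gl; rewrite [X in X @ _ --> _](_ : _ = pseries f x \+ pseries g x).
  exact: cvgD.
apply/funext => n; rewrite /pseries /series /= -big_split.
by apply: eq_bigr => i _; rewrite mulrDl.
Qed.

Lemma pseriesZ c f x l : pseries f x @ \oo --> l ->
  pseries (fun m => c * f m) x @ \oo --> c * l.
Proof.
move=> fl; rewrite [X in X @ _ --> _](_ : _ = (fun n => c * pseries f x n)).
  by apply: cvgM => //; exact: cvg_cst.
apply/funext => n; rewrite /pseries /series /= mulr_sumr.
by apply: eq_bigr => i _; rewrite mulrA.
Qed.

(** The Euler operator x d/dx multiplies the m-th coefficient by m; every
    differential equation below is read off the coefficients through it. *)
Lemma pseries_theta x f : exp_dominated f ->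
  pseries (fun m => m%:R * f m) x @ \oo --> x * psum (pseries_diffs f) x.
Proof.
move=> fd; have := @pseries_shift (fun m => m%:R * f m) x _
  (psum_cvg (exp_dominated_diffs fd)).
by rewrite mul0r add0r.
Qed.

Lemma psum0 f : psum f 0 = f 0%N.
Proof.
apply: psumE; rewrite -cvg_shiftS; apply: cvg_near_cst.
near=> n; rewrite /pseries /series /= big_nat_recl // expr0 mulr1 big1 ?addr0 //.
by move=> i _; rewrite expr0n mulr0.
Unshelve. all: end_near. Qed.

End EntireSeries.

Arguments psum_cvg {R} x {f}.
Arguments pseries_theta {R} x {f}.
Arguments pseriesZ {R} c {f x l}.

(** * The Bessel-type function *)

Section Bessel.
Context {R : realType}.
Variable b : R.
Hypothesis b_ge : 3 / 2 <= b.

(** The coefficients in z of 0F1(; b; - z).  With z = r^2 / 4 this is the Bessel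
    function of order b - 1 at r, divided by its leading power of r / 2 and
    normalised to 1 at 0. *)
Definition bessel_coef (m : nat) : R := (-1) ^+ m / (m`!%:R * pochhammer b m).

Let h := psum bessel_coef.
Let h1 := psum (pseries_diffs bessel_coef).
Let h2 := psum (pseries_diffs (pseries_diffs bessel_coef)).

Lemma pochhammerS (c : R) m : pochhammer c m.+1 = pochhammer c m * (c + m%:R).
Proof. by rewrite /pochhammer big_ord_recr. Qed.

Lemma pochhammer_gt0 (c : R) m : 0 < c -> 0 < pochhammer c m.
Proof. by move=> c0; apply: prodr_gt0 => i _; rewrite ltr_wpDr. Qed.

Let b_gt0 : 0 < b. Proof. by apply: lt_le_trans b_ge; lra. Qed.

Lemma bessel_coefS m :
  m.+1%:R * (b + m%:R) * bessel_coef m.+1 = - bessel_coef m.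
Proof.
have := @pochhammer_gt0 b m b_gt0; have : b + m%:R != 0 by rewrite gt_eqF // ltr_wpDr.
rewrite /bessel_coef pochhammerS factS natrM exprS; move: (pochhammer b m) => P bm P0.
have f0 : m`!%:R != 0 :> R by rewrite pnatr_eq0 -lt0n fact_gt0.
have m0 : m.+1%:R != 0 :> R by rewrite pnatr_eq0.
by move: m0; rewrite -natr1 => m0; field; rewrite m0 f0 bm gt_eqF.
Qed.

Lemma bessel_coef_dominated : exp_dominated bessel_coef.
Proof.
exists 1 => m; rewrite /bessel_coef normrM normrX normrN1 expr1n !mul1r.
have P1 : 1 <= pochhammer b m.
  elim: m => [|m IH]; first by rewrite /pochhammer big_ord0.
  rewrite pochhammerS -[1]mulr1 ler_pM // (le_trans _ (_ : b <= _)) ?lerDl //.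
  by apply: le_trans b_ge; lra.
have f0 : 0 < m`!%:R :> R by rewrite ltr0n fact_gt0.
have fP0 : 0 < m`!%:R * pochhammer b m by rewrite mulr_gt0 // (lt_le_trans _ P1).
rewrite ger0_norm; last by rewrite invr_ge0 ltW.
rewrite lef_pV2 ?posrE //.
by rewrite ler_peMr // ltW.
Qed.

Let hd := bessel_coef_dominated.

(** This is the two-term recurrence [bessel_coefS] in terms of the sums. *)
Lemma bessel_ode (z : R) : z * h2 z + b * h1 z + h z = 0.
Proof.
have d1 := exp_dominated_diffs hd.
have := pseriesD (pseriesD (pseries_theta z d1) (pseriesZ b (psum_cvg z d1))) (psum_cvg z hd).
move=> /psumE <-; rewrite /psum.
rewrite [pseries _ _](_ : _ = cst 0) ?lim_cst //.
apply/funext => n; rewrite /pseries /series /= big1 // => m _.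
rewrite /pseries_diffs -[bessel_coef m]opprK -bessel_coefS.
by rewrite [X in X * _](_ : _ = 0) ?mul0r //; ring.
Qed.

(** By the differential equation, the energy h^2 + z h'^2 has derivative
    (1 - 2 b) h'^2, hence decreases from its value 1 at z = 0. *)
Lemma bessel_sqr_le1 (z : R) : 0 <= z -> h z ^+ 2 <= 1.
Proof.
move=> z0; pose E (t : R) := h t ^+ 2 + t * h1 t ^+ 2.
have dh (t : R) : is_derive t 1 h (h1 t) by exact: is_derive_psum.
have dh1 (t : R) : is_derive t 1 h1 (h2 t) by apply: is_derive_psum; exact: exp_dominated_diffs.
have : E z <= E 0.
  apply: (@le0_derive_anti _ E (fun t => (1 - 2 * b) * h1 t ^+ 2) 0) => // t t0.
    rewrite /E; apply: is_derive_eq.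
    rewrite /GRing.scale /=.
    have := bessel_ode t; move: (h t) (h1 t) (h2 t) => x y w tw.
    apply: subr0_eq; rewrite [LHS](_ : _ = 2 * y * (t * w + b * y + x)); last by ring.
    by rewrite tw mulr0.
  by rewrite mulr_le0_ge0 ?sqr_ge0 //; move: b_ge; lra.
have -> : E 0 = 1.
  rewrite /E mul0r addr0 /h psum0 /bessel_coef /pochhammer big_ord0 fact0.
  by rewrite expr0 mulr1 divr1 expr1n.
by apply: le_trans; rewrite lerDl mulr_ge0 ?sqr_ge0.
Qed.

(** In the variable r, with z = r^2 / 4 and j(r) = h(z), the function r j obeys
    (r j)'' = - r j - (2 b - 3) j', which makes
    (r j)^2 + ((r j)')^2 + (2 b - 3) j^2 nonincreasing when 2 b >= 3.  [W] is this
    energy written in z; its value at 0 is 2 b - 2. *)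
Lemma bessel_sqr_decay (z : R) : 0 <= z -> 4 * z * h z ^+ 2 <= 2 * b - 2.
Proof.
move=> z0.
pose W (t : R) := 4 * t * h t ^+ 2 + (h t + 2 * t * h1 t) ^+ 2 + (2 * b - 3) * h t ^+ 2.
have dh (t : R) : is_derive t 1 h (h1 t) by exact: is_derive_psum.
have dh1 (t : R) : is_derive t 1 h1 (h2 t) by apply: is_derive_psum; exact: exp_dominated_diffs.
have b3 : 0 <= 2 * b - 3 by move: b_ge; lra.
have : W z <= W 0.
  apply: (@le0_derive_anti _ W (fun t => - (4 * t * (2 * b - 3) * h1 t ^+ 2)) 0) => // t t0.
    rewrite /W; apply: is_derive_eq.
    rewrite /GRing.scale /=.
    have := bessel_ode t; move: (h t) (h1 t) (h2 t) => x y w tw.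
    apply: subr0_eq.
    rewrite [LHS](_ : _ = 4 * (x + 2 * t * y) * (t * w + b * y + x)); last by ring.
    by rewrite tw mulr0.
  by rewrite oppr_le0 mulr_ge0 ?sqr_ge0 // !mulr_ge0.
have -> : W 0 = 2 * b - 2.
  rewrite /W /h psum0 /bessel_coef /pochhammer big_ord0 fact0 expr0 mulr1 divr1.
  by ring.
apply: le_trans; rewrite /W -addrA lerDl addr_ge0 ?sqr_ge0 //.
by rewrite mulr_ge0 // sqr_ge0.
Qed.

End Bessel.

(** * Averages against a power of the variable *)

Section PowerMean.
Context {R : realType}.
Variables (a : R) (f : nat -> R).
Hypotheses (a_gt0 : 0 < a) (fd : exp_dominated f).

(** The coefficients of the average of [psum f (s * z)] over s in the unit
    interval against the density a s^(a - 1), whose m-th moment is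
    a / (a + m). *)
Definition power_mean_coef m : R := a / (a + m%:R) * f m.

Let g := psum power_mean_coef.

Lemma power_mean_dominated : exp_dominated power_mean_coef.
Proof.
apply: (@exp_dominatedM _ _ 1 _ _ fd) => m.
have am : 0 < a + m%:R by rewrite ltr_wpDr.
by rewrite ger0_norm ?divr_ge0 ?(ltW a_gt0) ?(ltW am) // ler_pdivrMr // mul1r lerDl.
Qed.

Lemma power_mean_ode z :
  z * psum (pseries_diffs power_mean_coef) z + a * g z = a * psum f z.
Proof.
have gd := power_mean_dominated.
have := pseriesD (pseries_theta z gd) (pseriesZ a (psum_cvg z gd)).
rewrite (_ : (fun m => _) = (fun m => a * f m)) => [/psumE <-|].
  by apply/psumE/pseriesZ/psum_cvg.
apply/funext => m; rewrite /power_mean_coef -mulrDl addrC.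
have am : a + m%:R != 0 by rewrite gt_eqF // ltr_wpDr.
by rewrite mulrA mulrCA mulfV // mulr1.
Qed.

(** z^a g(z) is the integral from 0 to z of a t^(a - 1) f(t), so its derivative
    is explicit; sign and size of f carry over to g by monotonicity alone. *)
Lemma is_derive_power_mean (z : R) : 0 < z ->
  is_derive z 1 (fun t => t `^ a * g t) (a * z `^ (a - 1) * psum f z).
Proof.
move=> z0; have dg : is_derive z 1 g _ := is_derive_psum z power_mean_dominated.
have dp := is_derive1_powR a z0.
apply: is_derive_eq; rewrite /GRing.scale /=.
rewrite [RHS](_ : _ = z `^ (a - 1) * (a * psum f z)); last by ring.
rewrite -power_mean_ode -(mulr_powRB1 (ltW z0) a_gt0) -/g.
by ring.
Qed.

Lemma power_mean_ler (x y : R) : 0 < x -> x <= y ->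
    (forall t, x <= t -> 0 <= psum f t) ->
  x `^ a * g x <= y `^ a * g y.
Proof.
move=> x0 xy f0; rewrite -lerN2.
apply: (@le0_derive_anti _ (fun t => - (t `^ a * g t))
  (fun t => - (a * t `^ (a - 1) * psum f t)) x) => // t xt.
  by have d := is_derive_power_mean (lt_le_trans x0 xt); apply: is_derive_eq.
by rewrite oppr_le0 !mulr_ge0 ?powR_ge0 ?f0 // ltW.
Qed.

(** Integrating the bound on f from 1 to t gives a multiple of
    t^(a - th) - 1, which is dominated by t^(a - th) or by a constant according
    to the sign of a - th; dividing by t^a leaves the smaller of the two rates. *)
Lemma power_mean_decay (K th : R) : th != a ->
    (forall t, 1 <= t -> `|psum f t| <= K * t `^ (- th)) ->
  exists C : R, forall t, 1 <= t -> `|g t| <= C * t `^ (- Num.min a th).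
Proof.
move=> tha fK; pose c := a * K / (a - th).
have ath : a - th != 0 by rewrite subr_eq0 eq_sym.
(* [s] is a sign: both choices together bound the absolute value. *)
have D (s : R) : `|s| = 1 -> forall t, 1 <= t ->
    s * (t `^ a * g t) <= s * g 1 - c + c * t `^ (a - th).
  move=> s1 t t1.
  suff : s * (t `^ a * g t) - c * t `^ (a - th) <= s * (1 `^ a * g 1) - c * 1 `^ (a - th).
    by rewrite !powR1 mulr1 mul1r; lra.
  apply: (@le0_derive_anti _ (fun t => s * (t `^ a * g t) - c * t `^ (a - th))
    (fun t => s * (a * t `^ (a - 1) * psum f t) - c * ((a - th) * t `^ (a - th - 1))) 1)
    => // u u1; have u0 : 0 < u by rewrite (lt_le_trans _ u1).
    have d := is_derive_power_mean u0; have dp := is_derive1_powR (a - th) u0.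
    by apply: is_derive_eq; rewrite /GRing.scale /=; ring.
  rewrite subr_le0 [leRHS](_ : _ = a * K * u `^ (a - th - 1)); last first.
    by rewrite /c mulrA divfK.
  rewrite [a - th - 1](_ : _ = (a - 1) + (- th)); last by ring.
  rewrite [X in _ <= _ * X]powRD; last by rewrite (gt_eqF u0) implybT.
  rewrite (le_trans (ler_norm _)) // normrM s1 mul1r normrM.
  have au : 0 <= a * u `^ (a - 1) by rewrite mulr_ge0 ?powR_ge0 // ltW.
  rewrite (ger0_norm au).
  rewrite [leRHS](_ : _ = a * u `^ (a - 1) * (K * u `^ (- th))); last by ring.
  by rewrite ler_wpM2l // fK.
exists (`|g 1| + `|c|) => t t1; have t0 : 0 < t by rewrite (lt_le_trans _ t1).
rewrite -(ler_pM2l (powR_gt0 a t0)) mulrCA -powRD; last by rewrite (gt_eqF t0) implybT.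
set e := a - Num.min a th; have e0 : 0 <= e by rewrite subr_ge0 ge_min lexx.
have te : 1 <= t `^ e by rewrite -(powRr0 t) ler_powR.
have {D} : `|t `^ a * g t| <= `|g 1| - c + c * t `^ (a - th).
  rewrite ler_norml; apply/andP; split.
    have := D (-1) (normrN1 _) t t1; have := ler_norm (- g 1); rewrite normrN; lra.
  have := D 1 (normr1 _) t t1; have := ler_norm (g 1); lra.
rewrite normrM (ger0_norm (powR_ge0 _ _)) => /le_trans; apply.
rewrite mulrDl -addrA lerD //; first by rewrite ler_peMr.
have cle := ler_norm c; have cge := ler_norm (- c); rewrite normrN in cge.
have c0 := normr_ge0 c; have X0 := powR_ge0 t (a - th).
move: e0 te; rewrite /e; case: (ltgtP th a) tha => // [lt|gt] _ _.
  rewrite -subr_ge0 => X1; have := ler_wpM2r X1 cle; lra.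
rewrite subrr powRr0 => _.
have X1 : 0 <= 1 - t `^ (a - th).
  by rewrite subr_ge0 -(powRr0 t) ler_powR // subr_le0 ltW.
have := ler_wpM2r X1 cge; have := mulr_ge0 c0 X0; lra.
Qed.

End PowerMean.

(** * The hypergeometric functions of the multipliers *)

Section Symbols.
Context {R : realType}.
Variables a b : R.
Hypotheses (a_gt0 : 0 < a) (a_lt1 : a < 1) (b_ge : 3 / 2 <= b).

Let b_gt0 : 0 < b. Proof. by apply: lt_le_trans b_ge; lra. Qed.

(** The coefficients of b (1 - h(z)) / z, the defect of h from its value at 0. *)
Definition defect_coef (m : nat) : R := - b * bessel_coef b m.+1.

Let h := psum (bessel_coef b).
Let q := psum defect_coef.
Let F := psum (power_mean_coef a defect_coef).
Let G := psum (power_mean_coef a (bessel_coef b)).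

Let hd := bessel_coef_dominated b_ge.

Lemma defect_dominated : exp_dominated defect_coef.
Proof.
by apply: (exp_dominatedM (K := `|b|)) (exp_dominatedS hd) => m; rewrite normrN.
Qed.

Lemma defectE z : z * q z = b * (1 - h z).
Proof.
have := pseries_shift (psum_cvg z (exp_dominatedS hd)) => /psumE hE.
have /psumE := pseriesZ (- b) (psum_cvg z (exp_dominatedS hd)).
rewrite -[psum _ z]/(q z) => ->.
rewrite /h hE (_ : bessel_coef b 0 = 1); first by ring.
by rewrite /bessel_coef /pochhammer big_ord0 fact0 expr0 mulr1 divr1.
Qed.

Lemma pochhammer_succ (c : R) m : c * pochhammer (c + 1) m = pochhammer c m * (c + m%:R).
Proof.
rewrite -pochhammerS /pochhammer big_ord_recl /= addr0; congr (_ * _).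
by apply: eq_bigr => i _; rewrite -addrA nat1r.
Qed.

Lemma pochhammer1 m : pochhammer 1 m = m`!%:R :> R.
Proof.
elim: m => [|m IH]; first by rewrite /pochhammer big_ord0.
by rewrite pochhammerS IH factS natrM mulrC nat1r.
Qed.

Let am_neq0 m : a + m%:R != 0.
Proof. by rewrite gt_eqF // ltr_wpDr. Qed.

Let bm_neq0 m : b + m%:R != 0.
Proof. by rewrite gt_eqF // ltr_wpDr. Qed.

Let fact_neq0 m : m`!%:R != 0 :> R.
Proof. by rewrite pnatr_eq0 -lt0n fact_gt0. Qed.

Let pochhammer_a1 (c : R) m : 0 < c ->
  pochhammer (c + 1) m = pochhammer c m * (c + m%:R) / c.
Proof. by move=> c0; rewrite -pochhammer_succ mulrAC divff ?mul1r // gt_eqF. Qed.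

Lemma hyperF_12 z : hyperF [:: a] [:: b; a + 1] (- z) = G z.
Proof.
rewrite /hyperF /G /psum /pseries; congr (limn (series _)); apply/funext => m.
rewrite [RHS]/=.
rewrite !(big_cons, big_nil) !mulr1 !pochhammer_a1 // exprNn.
rewrite /power_mean_coef /bessel_coef.
have := gt_eqF (pochhammer_gt0 m a_gt0); have := gt_eqF (pochhammer_gt0 m b_gt0).
move: (am_neq0 m) (fact_neq0 m).
move: (pochhammer a m) (pochhammer b m) ((-1) ^+ m) (z ^+ m) (m`!%:R) => A P s y f.
move=> am f0 /negbT P0 /negbT A0; field.
by rewrite am f0 A0 P0 (gt_eqF a_gt0).
Qed.

Lemma hyperF_23 z : hyperF [:: 1; a] [:: 2; b + 1; a + 1] (- z) = F z.
Proof.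
rewrite /hyperF /F /psum /pseries; congr (limn (series _)); apply/funext => m.
rewrite [RHS]/=.
rewrite !(big_cons, big_nil) !mulr1 (_ : 2 = 1 + 1) // !pochhammer_a1 // exprNn.
rewrite /power_mean_coef /defect_coef /bessel_coef pochhammer1 factS pochhammerS natrM exprS.
have := gt_eqF (pochhammer_gt0 m a_gt0); have := gt_eqF (pochhammer_gt0 m b_gt0).
have : m.+1%:R != 0 :> R by rewrite pnatr_eq0.
rewrite -nat1r.
move: (am_neq0 m) (bm_neq0 m) (fact_neq0 m).
move: (pochhammer a m) (pochhammer b m) ((-1) ^+ m) (z ^+ m) (m`!%:R) => A P s y f.
move=> am bm f0 m1 /negbT P0 /negbT A0; field.
by rewrite am bm f0 m1 A0 P0 (gt_eqF a_gt0) (gt_eqF b_gt0).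
Qed.

(** The parameter 5/2 over 3/2 multiplies the m-th coefficient by
    (2 m + 3) / 3, and 2 m + 3 = (3 - 2 a) + 2 (a + m), whose second part cancels
    the denominator of the average.  For 0 < a < 1 both resulting terms are
    nonnegative. *)
Lemma hyperF_34 z :
  3 * hyperF [:: 1; 5 / 2; a] [:: 2; 3 / 2; b + 1; a + 1] (- z)
  = (3 - 2 * a) * F z + 2 * a * q z.
Proof.
have qd := defect_dominated; have Fd := power_mean_dominated a_gt0 qd.
have := pseriesZ (3^-1) (pseriesD (pseriesZ (3 - 2 * a) (psum_cvg z Fd))
  (pseriesZ (2 * a) (psum_cvg z qd))).
move=> /psumE /esym /(congr1 (fun y => 3 * y)); rewrite mulVKf // -/(F z) -/(q z) => ->.
congr (_ * _).
rewrite /hyperF /F /psum /pseries; congr (limn (series _)); apply/funext => m.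
rewrite [RHS]/=.
rewrite !(big_cons, big_nil) !mulr1 (_ : 2 = 1 + 1) //.
rewrite (_ : 5 / (1 + 1) = 3 / (1 + 1) + 1); last by field.
have t0 : 0 < 3 / (1 + 1) :> R by rewrite divr_gt0.
rewrite !pochhammer_a1 //.
rewrite exprNn /power_mean_coef /defect_coef /bessel_coef pochhammer1 factS pochhammerS natrM exprS.
have := gt_eqF (pochhammer_gt0 m t0).
have := gt_eqF (pochhammer_gt0 m a_gt0); have := gt_eqF (pochhammer_gt0 m b_gt0).
have : m.+1%:R != 0 :> R by rewrite pnatr_eq0.
rewrite -nat1r.
move: (am_neq0 m) (bm_neq0 m) (fact_neq0 m).
move: (pochhammer a m) (pochhammer b m) (pochhammer _ m) ((-1) ^+ m) (z ^+ m) (m`!%:R).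
move=> A P B s y f.
move=> am bm f0 m1 /negbT P0 /negbT A0 /negbT B0; field.
by rewrite am bm f0 m1 A0 P0 B0 (gt_eqF a_gt0) (gt_eqF b_gt0).
Qed.

Let h_le1 t : 0 < t -> `|h t| <= 1.
Proof.
move=> t0; rewrite -(@ler_pXn2r _ 2) ?nnegrE // expr1n real_normK ?num_real //.
by rewrite bessel_sqr_le1 // ltW.
Qed.

Lemma defect_ge0 t : 0 < t -> 0 <= q t.
Proof.
move=> t0; rewrite -(pmulr_rge0 _ t0) defectE mulr_ge0 ?(ltW b_gt0) // subr_ge0.
exact: le_trans (ler_norm _) (h_le1 t0).
Qed.

Lemma defect_le t : 1 <= t -> `|q t| <= 2 * b * t `^ (- 1).
Proof.
move=> t1; have t0 : 0 < t by rewrite (lt_le_trans _ t1).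
rewrite ger0_norm ?defect_ge0 // powR_inv1 ?(ltW t0) // ler_pdivlMr // mulrC defectE.
rewrite (mulrC 2) ler_pM2l //.
by have := h_le1 t0; have := ler_norm (- h t); rewrite normrN; lra.
Qed.

Lemma defect_mean_ler x y : 0 < x -> x <= y -> x `^ a * F x <= y `^ a * F y.
Proof.
move=> x0 xy; apply: power_mean_ler => //; first exact: defect_dominated.
by move=> t xt; apply: defect_ge0; rewrite (lt_le_trans x0).
Qed.

(** F is 1 at 0, hence positive near 0, and the monotonicity of t^a F(t) carries
    positivity to every larger argument. *)
Lemma defect_mean_gt0 t : 0 < t -> 0 < F t.
Proof.
move=> t0; have dF := is_derive_psum 0 (power_mean_dominated a_gt0 defect_dominated).
have cF : {for 0, continuous F}.
  exact: is_derive_continuous dF.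
have F0 : F 0 = 1.
  rewrite /F psum0 /power_mean_coef addr0 divff ?gt_eqF // mul1r.
  rewrite /defect_coef mulNr -mulrN.
  have := @bessel_coefS _ _ b_ge 0; rewrite addr0 mul1r => /(congr1 -%R).
  rewrite opprK -mulrN => ->.
  by rewrite /bessel_coef /pochhammer big_ord0 fact0 expr0 mulr1 divr1.
have : \forall s \near 0, 0 < F s by apply: cvgr_gt cF _ _; rewrite F0.
move=> /nbhs_ballP[e /= e0 Fe].
have [s [s0 st sF]] : exists s, [/\ 0 < s, s <= t & 0 < F s].
  exists (Num.min t (e / 2)); rewrite lt_min t0 divr_gt0 // ge_min lexx; split=> //.
  apply: Fe; rewrite /ball /= sub0r normrN ger0_norm.
    by rewrite gt_min ltr_pdivrMr // mulr_natr mulr2n ltrDl e0 orbT.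
  by rewrite le_min !ltW // divr_gt0.
rewrite -(pmulr_rgt0 _ (powR_gt0 a t0)); apply: lt_le_trans (defect_mean_ler s0 st).
by rewrite mulr_gt0 ?powR_gt0.
Qed.

Lemma defect_mean_lower t : 1 <= t -> F 1 * t `^ (- a) <= F t.
Proof.
move=> t1; have t0 : 0 < t by rewrite (lt_le_trans _ t1).
by have := defect_mean_ler ltr01 t1; rewrite powR1 mul1r powRN ler_pdivrMr ?powR_gt0 // mulrC.
Qed.

Lemma defect_mean_upper : exists C, forall t, 1 <= t -> `|F t| <= C * t `^ (- a).
Proof.
have [|C FC] := power_mean_decay a_gt0 defect_dominated (K := 2 * b) (th := 1) _ defect_le.
  by rewrite gt_eqF.
by exists C; rewrite min_l ?ltW // in FC.
Qed.

(** The rate 1/2 of h is capped at a by the averaging, but since a < 1 both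
    numbers exceed a / 2: this leaves room for G^2 = o(t^(-a)). *)
Lemma bessel_mean_decay :
  exists C th, a < 2 * th /\ forall t, 1 <= t -> `|G t| <= C * t `^ (- th).
Proof.
have [th [th1 th2 th3]] : exists th, [/\ a < 2 * th, th < a & th <= 2^-1].
  (* a < 2 th amounts to a (1 - a) > 0, and th <= 1/2 to (1 - a) (2 - a) >= 0. *)
  exists (a * (3 - a) / 4).
  have aa : 0 < a * (1 - a) by rewrite mulr_gt0 // subr_gt0.
  have aa' : 0 < (1 - a) * (2 - a) by rewrite mulr_gt0 ?subr_gt0 // (lt_trans a_lt1) // ltr1n.
  by split; nra.
have hdecay t : 1 <= t -> `|h t| <= Num.sqrt b * t `^ (- th).
  move=> t1; have t0 : 0 < t by rewrite (lt_le_trans _ t1).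
  rewrite (@le_trans _ _ (Num.sqrt b * t `^ (- 2^-1))) //; last first.
    by rewrite ler_wpM2l ?sqrtr_ge0 // ler_powR // lerN2.
  rewrite powRN powR12_sqrt ?(ltW t0) // -sqrtrV ?(ltW t0) // -sqrtrM ?(ltW b_gt0) //.
  rewrite -sqrtr_sqr ler_wsqrtr // ler_pdivlMr //.
  by have := bessel_sqr_decay b_ge (ltW t0); have := b_gt0; rewrite -/(h t); nra.
have [|C GC] := power_mean_decay a_gt0 hd _ hdecay.
  by rewrite lt_eqF.
by exists C, th; split => //; rewrite min_r ?(ltW th2) in GC.
Qed.

End Symbols.

(** * Order of magnitude of the eigenvalues *)

Section PowerOrder.
Context {R : realType}.

(** On the compact interval from t1 to the threshold, continuity and positivity
    bound t^a Phi(t) from both sides. *)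
Lemma power_order_extend (Phi : R -> R) (a T c C : R) :
    continuous Phi -> (forall t, 0 < t -> 0 < Phi t) -> 0 < c ->
    (forall t, T <= t -> c * t `^ (- a) <= Phi t <= C * t `^ (- a)) ->
  forall t1, 0 < t1 -> exists c' C' : R, 0 < c' /\
    forall t, t1 <= t -> c' * t `^ (- a) <= Phi t <= C' * t `^ (- a).
Proof.
move=> cPhi Phi0 c0 PhiT t1 t10; pose T' := Num.max t1 T.
have t1T : t1 <= T' by rewrite le_max lexx.
pose psi t := t `^ a * Phi t.
have cpsi : {within `[t1, T'], continuous psi}.
  apply/continuous_in_subspaceT => t; rewrite inE /= in_itv /= => /andP[t1t _].
  apply: cvgM; last exact: cPhi.
  exact: is_derive_continuous (is_derive1_powR a (lt_le_trans t10 t1t)).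
have [m /[!in_itv] /= /andP[m1 _] psim] := EVT_min t1T cpsi.
have [M _ psiM] := EVT_max t1T cpsi.
exists (Num.min c (psi m)), (Num.max C (psi M)); split.
  by rewrite lt_min c0 mulr_gt0 ?powR_gt0 ?Phi0 // (lt_le_trans t10).
move=> t t1t; have t0 : 0 < t := lt_le_trans t10 t1t.
have [Tt|tT] := leP T' t.
  have /andP[lo hi] : c * t `^ (- a) <= Phi t <= C * t `^ (- a).
    by apply: PhiT; rewrite (le_trans _ Tt) // le_max lexx orbT.
  apply/andP; split; [apply: le_trans lo|apply: le_trans hi _];
    by rewrite ler_wpM2r ?powR_ge0 // ?ge_min ?le_max lexx.
have tI : t \in `[t1, T'] by rewrite in_itv /= t1t ltW.
have PhiE : Phi t = psi t * t `^ (- a).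
  by rewrite powRN /psi mulrAC divff ?mul1r // gt_eqF // powR_gt0.
rewrite PhiE; apply/andP; split; rewrite ler_wpM2r ?powR_ge0 //.
  by rewrite ge_min psim ?orbT.
by rewrite le_max psiM ?orbT.
Qed.

End PowerOrder.

Section SymbolOrder.
Context {R : realType}.
Variables a b : R.
Hypotheses (a_gt0 : 0 < a) (a_lt1 : a < 1) (b_ge : 3 / 2 <= b).

Let q := psum (defect_coef b).
Let F := psum (power_mean_coef a (defect_coef b)).
Let G := psum (power_mean_coef a (bessel_coef b)).

Let dq (t : R) := is_derive_psum t (defect_dominated b_ge).
Let dF (t : R) := is_derive_psum t (power_mean_dominated a_gt0 (defect_dominated b_ge)).
Let dG (t : R) := is_derive_psum t (power_mean_dominated a_gt0 (bessel_coef_dominated b_ge)).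

Lemma transverse_order (t1 : R) : 0 < t1 -> exists c C : R, 0 < c /\
  forall t, t1 <= t -> c * t `^ (- a) <= F t <= C * t `^ (- a).
Proof.
have [C FC] := defect_mean_upper a_gt0 a_lt1 b_ge.
apply: (@power_order_extend _ _ _ 1 (F 1) C).
- by move=> t; exact: is_derive_continuous (dF t).
- exact: defect_mean_gt0.
- exact: defect_mean_gt0.
move=> t t1'; rewrite defect_mean_lower //=.
exact: le_trans (ler_norm _) (FC t t1').
Qed.

(** The quotient of - lambda_1 by the squared frequency, with kap standing for
    lambda^* - mu. *)
Definition longitudinal (mu kap t : R) : R :=
  mu * ((3 - 2 * a) * F t + 2 * a * q t) + kap * G t ^+ 2.

(** The first summand is exactly of order t^(-a), and the square of G is of
    smaller order, so the sign of kap does not matter for large t; the positivity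
    hypothesis covers the remaining bounded range. *)
Lemma longitudinal_order (mu kap : R) : 0 < mu ->
    (forall t, 0 < t -> 0 < longitudinal mu kap t) ->
  forall t1, 0 < t1 -> exists c C : R, 0 < c /\
    forall t, t1 <= t -> c * t `^ (- a) <= longitudinal mu kap t <= C * t `^ (- a).
Proof.
move=> mu0 L0.
have [CF FC] := defect_mean_upper a_gt0 a_lt1 b_ge.
have [CG [th [ath GC]]] := bessel_mean_decay a_gt0 a_lt1 b_ge.
pose D := mu * (3 - 2 * a) * F 1; pose K := `|kap| * CG ^+ 2.
have a3 : 0 < 3 - 2 * a by move: a_lt1; lra.
have D0 : 0 < D by rewrite !mulr_gt0 // defect_mean_gt0.
have K0 : 0 <= K by rewrite mulr_ge0 // sqr_ge0.
pose e := 2 * th - a; have e0 : 0 < e by rewrite subr_gt0.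
(* Once t^e >= B, the summand with G takes away at most half of the main term. *)
pose B := 1 + 2 * K / D.
have B1 : 1 <= B by rewrite lerDl divr_ge0 ?(ltW D0) // mulr_ge0.
have T1 : 1 <= B `^ e^-1.
  by rewrite -(powRr0 B) ler_powR // invr_ge0 ltW.
have KG t : 1 <= t -> `|kap * G t ^+ 2| <= K * t `^ (- e) * t `^ (- a).
  move=> t1; have t0 : 0 < t by rewrite (lt_le_trans _ t1).
  rewrite -mulrA -powRD; last by rewrite (gt_eqF t0) implybT.
  rewrite (_ : - e + - a = - th * 2%:R); last by rewrite /e; ring.
  rewrite powRrM powR_mulrn ?powR_ge0 // /K -mulrA -exprMn normrM normrX.
  by rewrite ler_wpM2l // lerXn2r ?nnegrE // ?(le_trans _ (GC t t1)) // GC.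
apply: (@power_order_extend _ _ _ (B `^ e^-1) (D / 2)
  (mu * ((3 - 2 * a) * CF + 2 * a * (2 * b)) + K)) => //.
- move=> t; have := dq t; have := dF t; have := dG t => gG gF gq.
  apply: is_derive_continuous; rewrite /longitudinal; apply: is_derive_eq; reflexivity.
- by rewrite divr_gt0.
move=> t Tt; have t1 := le_trans T1 Tt; have t0 : 0 < t by rewrite (lt_le_trans _ t1).
have ta0 := powR_gt0 (- a) t0.
have tB : B <= t `^ e.
  have B0 : 0 <= B by rewrite (le_trans _ B1).
  rewrite -[leLHS](_ : (B `^ e^-1) `^ e = B).
    by rewrite ge0_ler_powR ?nnegrE ?(ltW e0) ?(ltW t0) ?powR_ge0.
  by rewrite -powRrM mulVf ?powRr1 // gt_eqF.
have KD : K * t `^ (- e) <= D / 2.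
  rewrite powRN ler_pdivrMr ?powR_gt0 //.
  have : D / 2 * B <= D / 2 * t `^ e by rewrite ler_wpM2l // divr_ge0 // ltW.
  apply: le_trans; rewrite /B mulrDr mulr1.
  rewrite [X in _ + X](_ : _ = K); first by rewrite lerDr divr_ge0 // ltW.
  by field; rewrite gt_eqF.
have KG1 : `|kap * G t ^+ 2| <= D / 2 * t `^ (- a).
  by apply: le_trans (KG t t1) _; rewrite ler_wpM2r // ltW.
have KG2 : `|kap * G t ^+ 2| <= K * t `^ (- a).
  apply: le_trans (KG t t1) _; rewrite ler_wpM2r ?(ltW ta0) //.
  by rewrite ler_piMr // -(powRr0 t) ler_powR // oppr_le0 ltW.
have lo : D * t `^ (- a) <= mu * ((3 - 2 * a) * F t).
  have := ler_wpM2l (ltW (mulr_gt0 mu0 a3)) (defect_mean_lower a_gt0 b_ge t1).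
  by rewrite /D -!mulrA.
have q0 := defect_ge0 b_ge t0.
have aq : 0 <= mu * (2 * a * q t) by rewrite !mulr_ge0 // ltW.
have hiF : mu * ((3 - 2 * a) * F t) <= mu * ((3 - 2 * a) * (CF * t `^ (- a))).
  rewrite !ler_wpM2l ?(ltW mu0) ?(ltW a3) //.
  exact: le_trans (ler_norm _) (FC t t1).
have hiq : mu * (2 * a * q t) <= mu * (2 * a * (2 * b * t `^ (- a))).
  rewrite ler_wpM2l ?(ltW mu0) // ler_wpM2l ?mulr_ge0 ?(ltW a_gt0) //.
  apply: le_trans (le_trans (ler_norm _) (defect_le b_ge t1)) _.
  rewrite ler_wpM2l ?mulr_ge0 ?(le_trans _ b_ge) ?divr_ge0 // ler_powR // lerN2.
  exact: ltW.
rewrite /longitudinal -/(F t) -/(q t) -/(G t).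
have := ler_norm (kap * G t ^+ 2); have := ler_norm (- (kap * G t ^+ 2)); rewrite normrN.
move=> n1 n2; apply/andP; split; lra.
Qed.

End SymbolOrder.

Section Eigenvalues.
Context {R : realType} {n : nat}.
Variables (mu lams delta beta : R).
Hypotheses (n_gt0 : (0 < n)%N) (delta_gt0 : 0 < delta) (mu_gt0 : 0 < mu).
Hypotheses (beta_gt : n%:R < beta) (beta_lt : beta < n%:R + 2).

Let a : R := (n%:R + 2 - beta) / 2.
Let b : R := (n%:R + 2) / 2.
Let kap : R := 4^-1 * delta ^+ 2.
Let al : R := (beta - n%:R) / 2.

Let a_gt0 : 0 < a. Proof. by rewrite divr_gt0 // subr_gt0. Qed.
Let a_lt1 : a < 1. Proof. by rewrite /a; move: beta_gt; lra. Qed.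
Let b_ge : 3 / 2 <= b.
Proof.
rewrite /b ler_pM2r ?invr_gt0 //.
by have : 1 <= n%:R :> R by [rewrite ler1n]; lra.
Qed.
Let kap_gt0 : 0 < kap. Proof. by rewrite mulr_gt0 // exprn_gt0. Qed.

Let F := psum (power_mean_coef a (defect_coef b)).
Let L := longitudinal a b mu (lams - mu).

Lemma lambda2E (v : 'cV[R]_n) :
  lambda2 mu delta beta v = - (enorm v ^+ 2 * (mu * F (kap * enorm v ^+ 2))).
Proof.
rewrite /lambda2 (_ : (n%:R + 4) / 2 = b + 1); last by rewrite /b; field.
rewrite (_ : (n%:R + 4 - beta) / 2 = a + 1); last by rewrite /a; field.
rewrite (_ : - (4^-1) * _ * _ = - (kap * enorm v ^+ 2)); last by rewrite /kap; ring.
by rewrite -/a hyperF_23 // -/(F _); ring.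
Qed.

Lemma lambda1E (v : 'cV[R]_n) :
  lambda1 mu lams delta beta v = - (enorm v ^+ 2 * L (kap * enorm v ^+ 2)).
Proof.
rewrite /lambda1 (_ : (n%:R + 4) / 2 = b + 1); last by rewrite /b; field.
rewrite (_ : (n%:R + 4 - beta) / 2 = a + 1); last by rewrite /a; field.
rewrite (_ : - (4^-1) * _ * _ = - (kap * enorm v ^+ 2)); last by rewrite /kap; ring.
rewrite -/a -/b hyperF_12 // mulNr /L /longitudinal -hyperF_34 //.
by congr (- (_ * (_ + _))); ring.
Qed.

(** Every t > 0 is attained as kap |v|^2, so a sign condition on all vectors is
    one on all positive arguments of the radial symbol. *)
Lemma exists_enorm (t : R) : 0 < t -> exists2 v : 'cV[R]_n, v != 0 & kap * enorm v ^+ 2 = t.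
Proof.
move=> t0; pose s := t / kap; have s0 : 0 < s by rewrite divr_gt0.
pose v : 'cV[R]_n := \col_i ((i == Ordinal n_gt0)%:R * Num.sqrt s).
have vE : enorm v ^+ 2 = s.
  rewrite enorm2E (bigD1 (Ordinal n_gt0)) //= big1 => [|i /negbTE i0].
    by rewrite addr0 mxE eqxx mul1r sqr_sqrtr // ltW.
  by rewrite mxE i0 mul0r expr0n.
exists v; first by rewrite -enorm2_eq0 vE gt_eqF.
by rewrite vE mulrC divfK // gt_eqF.
Qed.

Lemma freq_enorm_ge1 (k : 'cV[int]_n) : k != 0 -> 1 <= enorm (freq k : 'cV[R]_n) ^+ 2.
Proof.
move=> k0; rewrite enorm2E.
have [i ki] : exists i, k i 0 != 0.
  apply/existsP; rewrite -negb_forall; apply: contra k0 => /forallP k0.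
  by apply/eqP/colP => i; rewrite mxE; apply/eqP.
rewrite (bigD1 i) //= ler_wpDr ?sumr_ge0 // => [j _|]; first exact: sqr_ge0.
rewrite mxE -rmorphXn /= ler1z -gtz0_ge1 lt_neqAle sqr_ge0 andbT eq_sym.
by rewrite sqrf_eq0.
Qed.

(** For integer vectors s = |k|^2 >= 1, hence s <= 1 + s <= 2 s, and
    s (kap s)^(- a) is a multiple of s^al because 1 - a = al. *)
Lemma power_order_freq (Phi : R -> R) :
    (forall t1, 0 < t1 -> exists c C : R, 0 < c /\
       forall t, t1 <= t -> c * t `^ (- a) <= Phi t <= C * t `^ (- a)) ->
  exists c C : R, 0 < c /\ forall k : 'cV[int]_n, k != 0 ->
    let s := enorm (freq k : 'cV[R]_n) ^+ 2 in
    c * (1 + s) `^ al <= s * Phi (kap * s) <= C * (1 + s) `^ al.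
Proof.
move=> /(_ kap kap_gt0)[c [C [c0 PhiP]]].
exists (c * kap `^ (- a) / 2 `^ al), (`|C| * kap `^ (- a)); split.
  by rewrite divr_gt0 ?mulr_gt0 ?powR_gt0.
move=> k /freq_enorm_ge1; set s := enorm _ ^+ 2 => s1 /=.
have s0 : 0 < s by rewrite (lt_le_trans _ s1).
have al0 : 0 <= al by rewrite divr_ge0 // subr_ge0 ltW.
have sE : s * (kap * s) `^ (- a) = kap `^ (- a) * s `^ al.
  have al_gt0 : 0 < al by rewrite divr_gt0 // subr_gt0.
  rewrite powRM ?(ltW kap_gt0) ?(ltW s0) // mulrCA -(mulr_powRB1 (ltW s0) al_gt0).
  by congr (_ * (_ * _)); congr (_ `^ _); rewrite /al /a; field.
have /PhiP /andP[lo hi] : kap <= kap * s by rewrite ler_peMr // ltW.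
have {}lo := ler_wpM2l (ltW s0) lo; have {}hi := ler_wpM2l (ltW s0) hi.
rewrite [leLHS]mulrCA sE in lo; rewrite [leRHS]mulrCA sE in hi.
apply/andP; split; [apply: le_trans lo|apply: le_trans hi _].
  rewrite mulrAC ler_pdivrMr ?powR_gt0 // mulrA -!mulrA !ler_wpM2l ?powR_ge0 ?(ltW c0) //.
  by rewrite -powRM ?(ltW s0) //; apply: ge0_ler_powR => //; rewrite ?nnegrE; lra.
apply: (@le_trans _ _ (`|C| * (kap `^ (- a) * s `^ al))).
  by rewrite ler_wpM2r ?mulr_ge0 ?powR_ge0 // ler_norm.
rewrite mulrA ler_wpM2l ?mulr_ge0 ?powR_ge0 //.
by apply: ge0_ler_powR => //; rewrite ?nnegrE; lra.
Qed.

Hypothesis lambda1_lt0 : forall v : 'cV[R]_n, v != 0 -> lambda1 mu lams delta beta v < 0.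

Lemma eigenvalue_order : exists c C : R, 0 < c /\ forall k : 'cV[int]_n, k != 0 ->
  let X := (1 + enorm (freq k : 'cV[R]_n) ^+ 2) `^ al in
  c * X <= - lambda1 mu lams delta beta (freq k : 'cV[R]_n) <= C * X /\
  c * X <= - lambda2 mu delta beta (freq k : 'cV[R]_n) <= C * X.
Proof.
have L0 t : 0 < t -> 0 < L t.
  move=> /exists_enorm[v v0 <-]; have := lambda1_lt0 v0; rewrite lambda1E oppr_lt0.
  by rewrite pmulr_rgt0 // lt_neqAle sqr_ge0 eq_sym enorm2_eq0 v0.
have [c1 [C1 [c10 P1]]] := power_order_freq (longitudinal_order a_gt0 a_lt1 b_ge mu_gt0 L0).
have [c2 [C2 [c20 P2]]] := power_order_freq (transverse_order a_gt0 a_lt1 b_ge).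
exists (Num.min c1 (mu * c2)), (Num.max C1 (mu * C2)); split.
  by rewrite lt_min c10 mulr_gt0.
move=> k k0; have /= := P1 k k0; have /= := P2 k k0.
rewrite lambda1E lambda2E !opprK; set s := enorm _ ^+ 2; set X := _ `^ al.
have X0 : 0 <= X by exact: powR_ge0.
move=> /andP[lo2 hi2] /andP[lo1 hi1].
have {}lo2 := ler_wpM2l (ltW mu_gt0) lo2; have {}hi2 := ler_wpM2l (ltW mu_gt0) hi2.
rewrite [s * (mu * _)]mulrCA.
have mc1 : Num.min c1 (mu * c2) * X <= c1 * X by rewrite ler_wpM2r // ge_min lexx.
have mc2 : Num.min c1 (mu * c2) * X <= mu * c2 * X by rewrite ler_wpM2r // ge_min lexx orbT.
have MC1 : C1 * X <= Num.max C1 (mu * C2) * X by rewrite ler_wpM2r // le_max lexx.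
have MC2 : mu * C2 * X <= Num.max C1 (mu * C2) * X by rewrite ler_wpM2r // le_max lexx orbT.
split; apply/andP; split.
- exact: le_trans mc1 lo1.
- exact: le_trans hi1 MC1.
- by apply: le_trans mc2 _; rewrite -mulrA.
- by apply: le_trans _ MC2; rewrite -mulrA.
Qed.

End Eigenvalues.

(** * Unordered sums and term-by-term differentiation *)

Section UnorderedSums.
Context {R : realType} {I : choiceType}.
Implicit Types (f g M : I -> R) (A B : {fset I}).

Local Notation totally := (@summability.totally I).
Local Notation partial_sum := summability.partial_sum.

Definition bounded_sums M := exists C : R, forall A, \sum_(i <- A) M i <= C.

Definition usum f : R := lim (partial_sum f @ totally).

Lemma partial_sumE (V : zmodType) (f : I -> V) A : partial_sum f A = \sum_(i <- A) f i.
Proof. by rewrite big_seq_fsetE. Qed.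

Lemma le_partial_sum f A B : (forall i, 0 <= f i) -> (A `<=` B)%fset ->
  partial_sum f A <= partial_sum f B.
Proof.
move=> f0 AB; rewrite !partial_sumE.
rewrite (big_fsetID _ (mem A) B) /= (_ : [fset x in B | x \in A]%fset = A).
  by rewrite lerDl sumr_ge0.
apply/fsetP => x; rewrite !inE /=.
by case: (boolP (x \in A)) => [/(fsubsetP AB)->|]; rewrite ?andbF.
Qed.

Lemma ge0_partial_sum_cvg f : (forall i, 0 <= f i) -> bounded_sums f ->
  exists l : R, partial_sum f @ totally --> l.
Proof.
move=> f0 [C fC]; pose S := range (partial_sum f).
have supS : has_sup S.
  split; first by exists (partial_sum f fset0), fset0.
  by exists C => _ [A _ <-]; rewrite partial_sumE.
exists (sup S); apply/cvgrPdist_lt => e e0.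
have [_ [A _ <-] Ae] := sup_adherent e0 supS.
exists A => // B /= AB; have AleB := le_partial_sum f0 AB.
have BS : partial_sum f B <= sup S by apply: ub_le_sup; [case: supS|exists B].
by rewrite ger0_norm ?subr_ge0 //; lra.
Qed.

Lemma bounded_sums_ge0 f M : (forall i, `|f i| <= M i) -> forall i, 0 <= M i.
Proof. by move=> fM i; rewrite (le_trans _ (fM i)). Qed.

(** f = (f + M) - M is a difference of nonnegative families with bounded finite
    sums. *)
Lemma partial_sum_cvg f M : (forall i, `|f i| <= M i) -> bounded_sums M ->
  partial_sum f @ totally --> usum f.
Proof.
move=> fM [C MC]; have M0 := bounded_sums_ge0 fM.
have fD i : 0 <= f i + M i by have := ler_norm (- f i); rewrite normrN; have := fM i; lra.
have [l fl] : exists l : R, partial_sum (fun i => f i + M i) @ totally --> l.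
  apply: ge0_partial_sum_cvg => //; exists (C + C) => A; rewrite big_split lerD //.
  by apply: le_trans (MC A); apply: ler_sum => i _; apply: le_trans (ler_norm _) _.
have [m Mm] := ge0_partial_sum_cvg M0 (ex_intro _ C MC).
suff fE : partial_sum f @ totally --> l - m by apply: cvgP fE.
rewrite (_ : partial_sum f = partial_sum (fun i => f i + M i) \- partial_sum M).
  exact: cvgB.
by apply/funext => A /=; rewrite !partial_sumE big_split /= addrK.
Qed.

(** The tail of a dominated sum is at most the tail of the dominating one: the
    families M - f and M + f are nonnegative, so their finite sums increase. *)
Lemma partial_sum_usum_le f M A : (forall i, `|f i| <= M i) -> bounded_sums M ->
  `|usum f - partial_sum f A| <= usum M - partial_sum M A.
Proof.
move=> fM Mb; have M0 := bounded_sums_ge0 fM.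
have MM i : `|M i| <= M i by rewrite ger0_norm.
have cM := partial_sum_cvg MM Mb.
have key g : (forall i, `|g i| <= M i) -> usum g - partial_sum g A <= usum M - partial_sum M A.
  move=> gM; have cg := partial_sum_cvg gM Mb.
  have cMg : (partial_sum M \- partial_sum g) @ totally --> usum M - usum g.
    exact: cvgB.
  have : partial_sum M A - partial_sum g A <= lim ((partial_sum M \- partial_sum g) @ totally).
    apply: limr_ge; first exact: cvgP cMg.
    exists A => // B /= AB; rewrite !partial_sumE -!sumrB -!partial_sumE.
    by apply: le_partial_sum => // i; rewrite subr_ge0 (le_trans (ler_norm _)).
  by rewrite (cvg_lim _ cMg) //; lra.
rewrite ler_norml; apply/andP; split; last exact: key.
have NM i : `|- f i| <= M i by rewrite normrN.
have := key _ NM.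
have -> : partial_sum (fun i => - f i) A = - partial_sum f A by rewrite !partial_sumE sumrN.
have -> : usum (fun i => - f i) = - usum f.
  apply: cvg_lim => //; rewrite (_ : partial_sum _ = - partial_sum f).
    exact: cvgN (partial_sum_cvg fM Mb).
  by apply/funext => B; rewrite opprfctE !partial_sumE sumrN.
lra.
Qed.

(** Tannery's theorem: outside a finite set carrying all but e / 3 of the mass of
    M both sums are small, and on that set convergence is termwise. *)
Lemma usum_dominated_cvg {T : Type} (F : set_system T) {FF : ProperFilter F}
    (g : T -> I -> R) l M :
    (forall i, g s i @[s --> F] --> l i) ->
    (\forall s \near F, forall i, `|g s i| <= M i) -> bounded_sums M ->
  usum (g s) @[s --> F] --> usum l.
Proof.
move=> gl gM Mb.
have lM i : `|l i| <= M i.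
  rewrite -(cvg_lim _ (cvg_norm (gl i))) //.
  by apply: limr_le; [exact: cvgP (cvg_norm (gl i))|apply: filterS gM].
have MM i : `|M i| <= M i by rewrite ger0_norm // (bounded_sums_ge0 lM).
apply/cvgrPdist_lt => e e0; have e3 : 0 < e / 3 by rewrite divr_gt0.
have /cvgrPdist_lt /(_ _ e3) [A _ /(_ A (fsubset_refl A)) /= MA] := partial_sum_cvg MM Mb.
have {}MA : usum M - partial_sum M A < e / 3 by apply: le_lt_trans MA; exact: ler_norm.
have cA : partial_sum (g s) A @[s --> F] --> partial_sum l A.
  rewrite partial_sumE (_ : (fun s => _) = (fun s => \sum_(i <- A) g s i)).
    by apply: cvg_big => //; exact: add_continuous.
  by apply/funext => s; rewrite partial_sumE.
near=> s.
have gsM : forall i, `|g s i| <= M i by near: s.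
have lgA : `|partial_sum l A - partial_sum (g s) A| < e / 3.
  by near: s; move/cvgrPdist_lt : cA; exact.
have lA := partial_sum_usum_le A lM Mb; have gA := partial_sum_usum_le A gsM Mb.
rewrite (_ : usum l - usum (g s) = (usum l - partial_sum l A)
  + (partial_sum l A - partial_sum (g s) A) - (usum (g s) - partial_sum (g s) A)); last by ring.
rewrite (le_lt_trans (ler_normB _ _)) // (le_lt_trans (lerD (ler_normD _ _) (lexx _))) //.
lra.
Unshelve. all: end_near. Qed.

Lemma usum_continuous (f : R -> I -> R) M t :
    (forall i, {for t, continuous (f ^~ i)}) -> (forall s i, `|f s i| <= M i) ->
  bounded_sums M -> {for t, continuous (fun s => usum (f s))}.
Proof.
by move=> fc fM Mb; apply: (usum_dominated_cvg fc _ Mb); apply: nearW => s; exact: fM.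
Qed.

End UnorderedSums.

Section TermwiseDerivative.
Context {R : realType}.

(** By the mean value theorem the difference quotients of the terms are dominated
    by the bound on the derivatives, so dominated summation applies to them. *)
Lemma is_derive_usum {I : choiceType} (f df : R -> I -> R) (M0 M : I -> R) (t : R) :
    (forall i (s : R), is_derive s 1 (f ^~ i) (df s i)) ->
    (forall s i, `|f s i| <= M0 i) -> bounded_sums M0 ->
    (forall s i, `|df s i| <= M i) -> bounded_sums M ->
  is_derive t 1 (fun s => usum (f s)) (usum (df t)).
Proof.
move=> fd fM0 M0b dfM Mb; apply/is_derive_cvgP.
have E h : h^-1 * (usum (f (h + t)) - usum (f t)) = usum (fun i => h^-1 * (f (h + t) i - f t i)).
  pose P u := summability.partial_sum (f u).
  suff cP : summability.partial_sum (fun i => h^-1 * (f (h + t) i - f t i))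
      @ summability.totally --> h^-1 * (usum (f (h + t)) - usum (f t)).
    by rewrite [RHS](cvg_lim _ cP).
  rewrite (_ : summability.partial_sum _ = (fun A => h^-1 * (P (h + t) A - P t A))).
    apply: cvgM; first exact: cvg_cst.
    by apply: cvgB; exact: partial_sum_cvg (fM0 _) M0b.
  by apply/funext => A; rewrite /P !partial_sumE -sumrB mulr_sumr.
rewrite (_ : (fun h => _) = (fun h => usum (fun i => h^-1 * (f (h + t) i - f t i)))); last first.
  exact/funext.
apply: (@usum_dominated_cvg _ _ _ _ _ _ _ M) => //.
  by move=> i; apply/is_derive_cvgP.
near=> h => i; have h0 : h != 0 by near: h; exact: nbhs_dnbhs_neq.
rewrite normrM normfV mulrC ler_pdivrMr ?normr_gt0 //.
have := @derive_bound_lipschitz _ (f ^~ i) (df ^~ i) (M i) (h + t) t (fd i) (dfM ^~ i).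
by rewrite addrK.
Unshelve. all: end_near. Qed.

End TermwiseDerivative.

(** * Oscillating series with vector coefficients *)

Section Oscillation.
Context {R : realType}.

(** The j-th derivative in t of (1 - cos (w t)) / w ^ 2.  It is identically zero
    for w = 0, as division by zero yields zero. *)
Definition osc (j : nat) (w t : R) : R :=
  (j == 0)%:R / w ^+ 2 - w ^+ j / w ^+ 2 * cos (w * t + j%:R * (pi / 2)).

Lemma is_derive_osc j w (t : R) : is_derive t 1 (osc j w) (osc j.+1 w t).
Proof.
have dlin : is_derive t 1 (fun s : R => w * s + j%:R * (pi / 2)) w.
  by apply: is_derive_eq; rewrite /GRing.scale /=; ring.
have dcos : is_derive t 1 (fun s => cos (w * s + j%:R * (pi / 2))) _ :=
  is_derive1_comp (f := cos) (is_derive_cos _) dlin.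
rewrite /osc; apply: is_derive_eq.
rewrite /GRing.scale /= -[j.+1%:R]natr1 [(_ + 1) * (pi / 2)]mulrDl mul1r addrA.
by rewrite cosDpihalf (exprS w j); ring.
Qed.

Lemma osc_le j w t : 0 <= w -> `|osc j w t| <= 2 * (w ^+ j / w ^+ 2).
Proof.
move=> w0; have wj : 0 <= w ^+ j / w ^+ 2 by rewrite divr_ge0 ?exprn_ge0.
rewrite /osc (le_trans (ler_normB _ _)) // (mulr_natl _ 2) mulr2n lerD //.
  case: j wj => [|j] wj; first by rewrite expr0 ger0_norm.
  by rewrite mul0r normr0.
by rewrite normrM (ger0_norm wj) ler_piMr // cos_max.
Qed.

(** The derivatives of t ^ 2 / 2, the amplitude of the constant mode. *)
Definition half_square (j : nat) (t : R) : R :=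
  match j with 0 => t ^+ 2 / 2 | 1 => t | 2 => 1 | _ => 0 end.

Lemma is_derive_half_square j (t : R) :
  is_derive t 1 (half_square j) (half_square j.+1 t).
Proof.
case: j => [|[|[|j]]] /=; try exact: is_derive_cst.
  by apply: is_derive_eq; rewrite /GRing.scale /=; field.
exact: is_derive_id.
Qed.

End Oscillation.

Section ComplexVectors.
Context {R : realType} {n : nat}.
Implicit Types (z : Cx R) (r : R).

(** Limits and derivatives are computed on real and imaginary parts of the
    entries, so that the real theory above applies. *)
Definition vec_of_parts (u v : 'I_n -> R) : 'cV[Cx R]_n := \col_i (u i +i* v i)%C.

Lemma vec_of_partsE (v : 'cV[Cx R]_n) :
  vec_of_parts (fun i => complex.Re (v i 0)) (fun i => complex.Im (v i 0)) = v.
Proof. by apply/colP => i; rewrite mxE; case: (v i 0). Qed.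

Lemma cvg_vec_of_parts {T : Type} (F : set_system T) {FF : Filter F}
    (u v : T -> 'I_n -> R) (a b : 'I_n -> R) :
    (forall i, u s i @[s --> F] --> a i) -> (forall i, v s i @[s --> F] --> b i) ->
  vec_of_parts (u s) (v s) @[s --> F] --> vec_of_parts a b.
Proof.
move=> ua vb; apply/cvg_ballP => e e0.
(* A positive element of the complex field is real. *)
have eE : e = ofR (complex.Re e).
  by move: e0; case: e => x y; rewrite ltcE /= => /andP[/eqP -> _].
have r0 : 0 < complex.Re e by move: e0; rewrite ltcE /= => /andP[].
have nu : \forall s \near F, forall i, `|a i - u s i| < complex.Re e / 2.
  by apply: filter_forall => i; move/cvgrPdist_lt : (ua i); apply; rewrite divr_gt0.
have nv : \forall s \near F, forall i, `|b i - v s i| < complex.Re e / 2.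
  by apply: filter_forall => i; move/cvgrPdist_lt : (vb i); apply; rewrite divr_gt0.
near=> s; split => // i j; rewrite !mxE /ball /= eE.
have su : `|a i - u s i| < complex.Re e / 2 by move: i; near: s.
have sv : `|b i - v s i| < complex.Re e / 2 by move: i {su}; near: s.
rewrite (_ : _ - _ = ((a i - u s i) +i* (b i - v s i))%C) //.
rewrite normc_def ltcR /=.
rewrite (le_lt_trans (_ : _ <= `|a i - u s i| + `|b i - v s i|)) //; last by lra.
move: (a i - u s i) (b i - v s i) => x y.
rewrite -(ger0_norm (addr_ge0 (normr_ge0 x) (normr_ge0 y))) -sqrtr_sqr ler_wsqrtr //.
rewrite sqrrD !real_normK ?num_real // addrAC lerDl.
by rewrite mulrn_wge0 // mulr_ge0.
Unshelve. all: end_near. Qed.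

Local Notation partial_sum := summability.partial_sum.

Lemma vec_of_partsD (u v u' v' : 'I_n -> R) :
  vec_of_parts u v + vec_of_parts u' v' = vec_of_parts (fun i => u i + u' i) (fun i => v i + v' i).
Proof. by apply/colP => i; rewrite !mxE. Qed.

Lemma vec_of_partsB (u v u' v' : 'I_n -> R) :
  vec_of_parts u v - vec_of_parts u' v' = vec_of_parts (fun i => u i - u' i) (fun i => v i - v' i).
Proof. by apply/colP => i; rewrite !mxE. Qed.

Lemma ofR_vec_of_parts r (u v : 'I_n -> R) :
  ofR r *: vec_of_parts u v = vec_of_parts (fun i => r * u i) (fun i => r * v i).
Proof.
apply/colP => i; rewrite !mxE /ofR; apply/eqP.
by rewrite eq_complex /= !mul0r subr0 addr0 !eqxx.
Qed.

Lemma sum_vec_of_parts (J : Type) (s : seq J) (u v : J -> 'I_n -> R) :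
  \sum_(k <- s) vec_of_parts (u k) (v k)
  = vec_of_parts (fun i => \sum_(k <- s) u k i) (fun i => \sum_(k <- s) v k i).
Proof.
elim: s => [|k s IH].
  by rewrite big_nil; apply/colP => i; rewrite !mxE !big_nil.
rewrite big_cons IH vec_of_partsD; congr vec_of_parts; apply/funext => i;
  by rewrite big_cons.
Qed.

Variable I : choiceType.
Variables (w1 w2 : I -> R) (V1 V2 : I -> 'cV[Cx R]_n) (v0 : 'cV[Cx R]_n).
Variables (m1 m2 : I -> R) (p : nat).

Definition osc_term (t : R) (k : I) : 'cV[Cx R]_n :=
  ofR (osc 0 (w1 k) t) *: V1 k + ofR (osc 0 (w2 k) t) *: V2 k.

Hypotheses (w1_ge0 : forall k, 0 <= w1 k) (w2_ge0 : forall k, 0 <= w2 k).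
Hypotheses
  (m1P : forall k i, `|complex.Re (V1 k i 0)| <= m1 k /\ `|complex.Im (V1 k i 0)| <= m1 k)
  (m2P : forall k i, `|complex.Re (V2 k i 0)| <= m2 k /\ `|complex.Im (V2 k i 0)| <= m2 k).
Hypothesis bounded_osc : forall j, (j <= p)%N ->
  bounded_sums (fun k => w1 k ^+ j / w1 k ^+ 2 * m1 k + w2 k ^+ j / w2 k ^+ 2 * m2 k).

(** The j-th derivative of one real component of the k-th term; e1 and e2 are
    the corresponding components of the two vector coefficients. *)
Let comp (e1 e2 : I -> R) (j : nat) (t : R) (k : I) : R :=
  osc j (w1 k) t * e1 k + osc j (w2 k) t * e2 k.

Let M (j : nat) (k : I) : R :=
  2 * (w1 k ^+ j / w1 k ^+ 2 * m1 k + w2 k ^+ j / w2 k ^+ 2 * m2 k).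

Let Mb j : (j <= p)%N -> bounded_sums (M j).
Proof.
move=> /bounded_osc[C MC]; exists (2 * C) => A.
by rewrite -mulr_sumr ler_wpM2l.
Qed.

Section Component.
Variables e1 e2 : I -> R.
Hypotheses (e1P : forall k, `|e1 k| <= m1 k) (e2P : forall k, `|e2 k| <= m2 k).

Let compM j t k : `|comp e1 e2 j t k| <= M j k.
Proof.
rewrite /M mulrDr [2 * (_ * m1 k)]mulrA [2 * (_ * m2 k)]mulrA (le_trans (ler_normD _ _)) // !normrM.
by rewrite lerD // ler_pM // osc_le.
Qed.

Lemma comp_cvg j t : (j <= p)%N ->
  partial_sum (comp e1 e2 j t) @ summability.totally --> usum (comp e1 e2 j t).
Proof. by move=> /Mb; exact: partial_sum_cvg. Qed.

Let is_derive_comp j k (t : R) :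
  is_derive t 1 (fun s => comp e1 e2 j s k) (comp e1 e2 j.+1 t k).
Proof.
have d1 := is_derive_osc j (w1 k) t; have d2 := is_derive_osc j (w2 k) t.
by apply: is_derive_eq; rewrite /comp /GRing.scale /=; ring.
Qed.

Lemma is_derive_usum_comp j (t : R) : (j < p)%N ->
  is_derive t 1 (fun s => usum (comp e1 e2 j s)) (usum (comp e1 e2 j.+1 t)).
Proof.
move=> jp.
exact: (is_derive_usum t (is_derive_comp j) (compM j) (Mb (ltnW jp)) (compM j.+1) (Mb jp)).
Qed.

Lemma usum_comp_continuous j (t : R) : (j <= p)%N ->
  {for t, continuous (fun s => usum (comp e1 e2 j s))}.
Proof.
move=> jp; apply: (usum_continuous (M := M j)) => //; last exact: Mb.
by move=> i; exact: is_derive_continuous (is_derive_comp j i t).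
Qed.

End Component.

Let Re1 i k := complex.Re (V1 k i 0).
Let Re2 i k := complex.Re (V2 k i 0).
Let Im1 i k := complex.Im (V1 k i 0).
Let Im2 i k := complex.Im (V2 k i 0).

Let Re1P i k : `|Re1 i k| <= m1 k. Proof. by have [] := m1P k i. Qed.
Let Re2P i k : `|Re2 i k| <= m2 k. Proof. by have [] := m2P k i. Qed.
Let Im1P i k : `|Im1 i k| <= m1 k. Proof. by have [] := m1P k i. Qed.
Let Im2P i k : `|Im2 i k| <= m2 k. Proof. by have [] := m2P k i. Qed.

Let osc_sum (j : nat) (t : R) : 'cV[Cx R]_n :=
  vec_of_parts (fun i => usum (comp (Re1 i) (Re2 i) j t))
               (fun i => usum (comp (Im1 i) (Im2 i) j t)).

Lemma osc_series_cvg t :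
  partial_sum (osc_term t) @ summability.totally --> osc_sum 0 t.
Proof.
rewrite (_ : partial_sum _ = fun A => vec_of_parts
   (fun i => partial_sum (comp (Re1 i) (Re2 i) 0 t) A)
   (fun i => partial_sum (comp (Im1 i) (Im2 i) 0 t) A)).
  by apply: cvg_vec_of_parts => i; apply: comp_cvg.
apply/funext => A; rewrite partial_sumE.
under eq_bigr => k _ do
  rewrite /osc_term -[V1 k]vec_of_partsE -[V2 k]vec_of_partsE !ofR_vec_of_parts vec_of_partsD.
by rewrite sum_vec_of_parts; congr vec_of_parts; apply/funext => i; rewrite partial_sumE.
Qed.

Let zero_mode (j : nat) (t : R) : 'cV[Cx R]_n := ofR (half_square j t) *: v0.

Let deriv (j : nat) (t : R) : 'cV[Cx R]_n := zero_mode j t + osc_sum j t.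

Let derivE j t : deriv j t = vec_of_parts
  (fun i => half_square j t * complex.Re (v0 i 0) + usum (comp (Re1 i) (Re2 i) j t))
  (fun i => half_square j t * complex.Im (v0 i 0) + usum (comp (Im1 i) (Im2 i) j t)).
Proof.
by rewrite /deriv /zero_mode -[v0]vec_of_partsE ofR_vec_of_parts vec_of_partsD vec_of_partsE.
Qed.

(** The derivative of order j is summed from the derivatives of order j of the
    terms; their common bounds do not depend on t. *)
Lemma osc_series_Cp : Cp_halfline p
  (fun t => ofR (t ^+ 2 / 2) *: v0 + lim (partial_sum (osc_term t) @ summability.totally)).
Proof.
exists deriv; split.
- move=> t _; rewrite /deriv /zero_mode /=; congr (_ + _); apply/esym/cvg_lim.
    exact: norm_hausdorff.
  exact: osc_series_cvg.
- move=> j t jp _; rewrite /is_halfline_derive.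
  under eq_fun do rewrite !derivE vec_of_partsB ofR_vec_of_parts.
  rewrite derivE; apply: cvg_vec_of_parts => i.
    apply: (@cvg_diff_quotient _ (fun s =>
      half_square j s * complex.Re (v0 i 0) + usum (comp (Re1 i) (Re2 i) j s))).
    have d1 := is_derive_half_square j t.
    have d2 := is_derive_usum_comp (Re1P i) (Re2P i) t jp.
    by apply: is_derive_eq; rewrite /GRing.scale /=; ring.
  apply: (@cvg_diff_quotient _ (fun s =>
      half_square j s * complex.Im (v0 i 0) + usum (comp (Im1 i) (Im2 i) j s))).
  have d1 := is_derive_half_square j t.
  have d2 := is_derive_usum_comp (Im1P i) (Im2P i) t jp.
  by apply: is_derive_eq; rewrite /GRing.scale /=; ring.
move=> j jp; apply: continuous_subspaceT => t.
rewrite /continuous_at derivE.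
under eq_cvg do rewrite derivE.
have ch := is_derive_continuous (is_derive_half_square j t).
apply: cvg_vec_of_parts => i; apply: cvgD; try exact: usum_comp_continuous.
  by apply: cvgM => //; exact: cvg_cst.
by apply: cvgM => //; exact: cvg_cst.
Qed.

End ComplexVectors.

(** * Summability over the integer lattice *)

Section BoundedSums.
Context {R : realType}.

Lemma bounded_sumsD (I : choiceType) (f g : I -> R) :
  bounded_sums f -> bounded_sums g -> bounded_sums (fun i => f i + g i).
Proof. by move=> [C fC] [D gD]; exists (C + D) => A; rewrite big_split lerD. Qed.

Lemma bounded_sumsZ (I : choiceType) (c : R) (f : I -> R) :
  0 <= c -> bounded_sums f -> bounded_sums (fun i => c * f i).
Proof. by move=> c0 [C fC]; exists (c * C) => A; rewrite -mulr_sumr ler_wpM2l. Qed.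

Lemma le_bounded_sums (I : choiceType) (f g : I -> R) :
  (forall i, f i <= g i) -> bounded_sums g -> bounded_sums f.
Proof. by move=> fg [C gC]; exists C => A; apply: le_trans (gC A); apply: ler_sum. Qed.

Lemma ler_sum_subset (T : eqType) (s r : seq T) (f : T -> R) :
  uniq s -> uniq r -> {subset s <= r} -> (forall i, 0 <= f i) ->
  \sum_(i <- s) f i <= \sum_(i <- r) f i.
Proof.
move=> us ur sr f0; rewrite [leRHS](bigID (mem s)) /= -[X in _ <= X + _]big_filter.
rewrite [X in _ <= X + _](perm_big s) /=; first by rewrite lerDl sumr_ge0.
apply: uniq_perm => //; first exact: filter_uniq.
by move=> x; rewrite mem_filter /=; apply/andP/idP => [[]//|xs]; split => //; exact: sr.
Qed.

Definition inv_sqr_int (m : int) : R := (1 + m%:~R ^+ 2)^-1.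

Lemma inv_sqr_int_ge0 m : 0 <= inv_sqr_int m.
Proof. by rewrite invr_ge0 addr_ge0 // sqr_ge0. Qed.

(** Telescoping: 1 / (1 + x^2) <= 4 / ((x + 1) (x + 2)), where the constant 4
    makes the numerator 3 x^2 - 3 x + 2 of the difference positive for all x. *)
Lemma sum_inv_sqr_nat N : \sum_(i < N) inv_sqr_int (Posz i) <= 4 - 4 / N.+1%:R.
Proof.
elim: N => [|N IH]; first by rewrite big_ord0 divr1 subrr.
rewrite big_ord_recr /= -lerBrDr; apply: le_trans IH _.
have N0 : 0 <= N%:R :> R by [].
rewrite (_ : inv_sqr_int (Posz N) = (1 + N%:R ^+ 2)^-1) //.
rewrite -[N.+2%:R]natr1 -[N.+1%:R]natr1 -subr_ge0.
move: (N%:R) N0 => x x0.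
have d1 : 0 < 1 + x ^+ 2 by have := sqr_ge0 x; lra.
have -> : 4 - 4 / (x + 1 + 1) - (1 + x ^+ 2)^-1 - (4 - 4 / (x + 1)) =
  (3 * x ^+ 2 - 3 * x + 2) / ((x + 1) * (x + 1 + 1) * (1 + x ^+ 2)).
  field; rewrite !gt_eqF //; lra.
apply: divr_ge0; first by have := sqr_ge0 (x - 1); have := sqr_ge0 x; nra.
by rewrite !mulr_ge0 ?(ltW d1) //; lra.
Qed.

Lemma bounded_inv_sqr_int : bounded_sums inv_sqr_int.
Proof.
exists 8 => A; pose N := (\max_(m <- A) `|m|%N).+1.
pose r := [seq Posz i | i <- iota 0 N] ++ [seq Negz i | i <- iota 0 N].
have sN : \sum_(i <- iota 0 N) inv_sqr_int (Posz i) <= 4.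
  rewrite -[N]subn0 -/(index_iota 0 N) big_mkord; apply: le_trans (sum_inv_sqr_nat N) _.
  by rewrite gerBl divr_ge0.
apply: (@le_trans _ _ (\sum_(m <- r) inv_sqr_int m)).
  apply: ler_sum_subset (inv_sqr_int_ge0) => [||m mA]; first exact: fset_uniq.
    rewrite cat_uniq !map_inj_uniq ?iota_uniq //; [|by move=> ? ? []|by move=> ? ? []].
    by rewrite andbT; apply/hasPn => _ /mapP[i _ ->]; apply/mapP => -[].
  have mN : (`|m| < N)%N by rewrite ltnS; apply: leq_bigmax_seq.
  rewrite mem_cat; case: m mA mN => m _ mN; apply/orP; [left|right]; apply: map_f.
    by rewrite mem_iota.
  by rewrite mem_iota /= add0n (ltn_trans _ mN).
rewrite big_cat !big_map (_ : 8 = 4 + 4); last by ring.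
rewrite lerD //; apply: le_trans sN; apply: ler_sum => i _.
have x0 : 0 <= i%:R :> R by [].
rewrite (_ : inv_sqr_int (Posz i) = (1 + i%:R ^+ 2)^-1) //.
rewrite (_ : inv_sqr_int (Negz i) = (1 + i.+1%:R ^+ 2)^-1); last first.
  by rewrite /inv_sqr_int NegzE mulrNz sqrrN.
rewrite lef_pV2 ?posrE ?ltr_wpDr ?sqr_ge0 // -natr1; nra.
Qed.

(** A finite set of lattice points embeds into a finite grid S^n, over which the
    sum of the product factors into the n-th power of one sum over S. *)
Lemma bounded_prod n (g : int -> R) : (forall m, 0 <= g m) -> bounded_sums g ->
  bounded_sums (fun k : 'cV[int]_n => \prod_i g (k i 0)).
Proof.
move=> g0 [C gC]; exists (C ^+ n) => A.
pose S : {fset int} := [fset (k : 'cV[int]_n) i 0 | k in A, i in 'I_n]%fset.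
have mS (k : A) (i : 'I_n) : val k i 0 \in S.
  by apply/imfset2P; exists (val k); [exact: fsvalP|exists i].
pose phi (k : A) : {ffun 'I_n -> S} := [ffun i => FSetSub (mS k i)].
have phi_inj : {in [set: A]%SET &, injective phi}.
  move=> k k' _ _ /ffunP e; apply/val_inj/colP => i.
  by have := congr1 val (e i); rewrite !ffunE.
rewrite big_seq_fsetE /=.
rewrite (eq_bigr (fun k : A => \prod_i g (val (phi k i)))); last first.
  by move=> k _; apply: eq_bigr => i _; rewrite ffunE.
rewrite (eq_bigl (fun k => k \in [set: A]%SET)); last by move=> k; rewrite inE.
rewrite -(big_imset (fun f : {ffun 'I_n -> S} => \prod_i g (val (f i))) phi_inj) /=.
apply: (@le_trans _ _ (\sum_(f : {ffun 'I_n -> S}) \prod_i g (val (f i)))).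
  rewrite [leRHS](bigID (mem (phi @: [set: A]%SET))) /= lerDl sumr_ge0 // => f _.
  exact: prodr_ge0.
rewrite -(bigA_distr_bigA (fun _ (m : S) => g (val m))) prodr_const card_ord.
have gS : \sum_(m : S) g (val m) <= C by rewrite -(big_seq_fsetE _ S xpredT g).
have gS0 : 0 <= \sum_(m : S) g (val m) by apply: sumr_ge0.
by rewrite lerXn2r ?nnegrE // (le_trans gS0).
Qed.

Let X n (k : 'cV[int]_n) : R := 1 + enorm (freq k : 'cV[R]_n) ^+ 2.

(** As 1 + |k|^2 is at least each 1 + k_i^2, its power -n is at most the product
    of the n inverses. *)
Lemma bounded_lattice_decay n (q : R) : n%:R <= q ->
  bounded_sums (fun k : 'cV[int]_n => X k `^ (- q)).
Proof.
move=> nq; apply: le_bounded_sums (bounded_prod n inv_sqr_int_ge0 bounded_inv_sqr_int) => k.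
have X1 : 1 <= X k by rewrite lerDl sqr_ge0.
have X0 : 0 < X k by rewrite (lt_le_trans _ X1).
apply: (@le_trans _ _ (X k `^ (- n%:R))); first by rewrite ler_powR // lerN2.
rewrite powR_invn ?(ltW X0) // -exprVn.
rewrite -[n in _ ^+ n]card_ord -prodr_const; apply: ler_prod => i _.
rewrite invr_ge0 (ltW X0) /= lef_pV2 ?posrE // ?ltr_wpDr ?sqr_ge0 //.
by rewrite lerD2l enorm2E (bigD1 i) //= mxE lerDl sumr_ge0 // => j _; exact: sqr_ge0.
Qed.

Lemma sobolev_bounded n (q : R) (g : periodic_distribution R n) : sobolev q g ->
  bounded_sums (fun k => X k `^ q * hnorm (g k) ^+ 2).
Proof.
rewrite /sobolev; set e := esum _ _ => efin; exists (fine e) => A.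
have e0 : (0 <= e)%E.
  by apply: esum_ge0 => k _; rewrite lee_fin mulr_ge0 ?powR_ge0 ?sqr_ge0.
rewrite -lee_fin fineK ?ge0_fin_numE // -sumEFin.
apply: esum_ge; exists [set` A]; first by split => //; exact: finite_fset.
by rewrite fsbig_finite //= set_fsetK.
Qed.

End BoundedSums.

(** * The Fourier series of the solution *)

Section Weights.
Context {R : realType}.

(** The sum on the right covers both signs of the exponent. *)
Lemma powR_between (c C u r : R) : 0 < c -> c <= u -> u <= C -> u `^ r <= c `^ r + C `^ r.
Proof.
move=> c0 cu uC; have u0 := lt_le_trans c0 cu; have C0 := lt_le_trans u0 uC.
have [r0|r0] := leP 0 r.
  by rewrite ler_wpDl ?powR_ge0 // ge0_ler_powR ?nnegrE ?(ltW u0) ?(ltW C0).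
rewrite ler_wpDr ?powR_ge0 // -[r]opprK !(powRN _ (- r)) lef_pV2 ?posrE ?powR_gt0 //.
by rewrite ge0_ler_powR ?nnegrE ?oppr_ge0 ?(ltW r0) ?(ltW c0) ?(ltW u0).
Qed.

Lemma sqrt_expr_div (y : R) (j : nat) : 0 < y ->
  Num.sqrt y ^+ j / Num.sqrt y ^+ 2 = y `^ ((j%:R - 2) / 2).
Proof.
move=> y0; have w0 : 0 < Num.sqrt y by rewrite sqrtr_gt0.
rewrite -!powR_mulrn ?(ltW w0) // -powRB; last by rewrite (gt_eqF w0) implybT.
by rewrite -powR12_sqrt ?(ltW y0) // -powRrM mulrC.
Qed.

(** With r = (j - 2) / 2 the weight on the left is y^r m, and y^r is at most a
    constant times X^(al r).  Now X^(al r) m splits as the product of X^(S/2) m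
    and X^(al r - S/2), and a product is at most the sum of the squares of its
    factors. *)
Lemma weight_le (c C X y al S m : R) (j : nat) :
    0 < c -> 0 < X -> 0 <= m -> c * X `^ al <= y -> y <= C * X `^ al ->
  Num.sqrt y ^+ j / Num.sqrt y ^+ 2 * m
    <= (c `^ ((j%:R - 2) / 2) + C `^ ((j%:R - 2) / 2)) *
       (X `^ S * m ^+ 2 + X `^ (- (S - al * (j%:R - 2)))).
Proof.
move=> c0 X0 m0 cy yC; set r := (j%:R - 2) / 2; have Xa := powR_gt0 al X0.
have y0 : 0 < y by apply: lt_le_trans cy; rewrite mulr_gt0.
rewrite sqrt_expr_div // -/r.
have -> : y `^ r = (y / X `^ al) `^ r * X `^ (al * r).
  by rewrite powRrM -powRM ?divr_ge0 ?(ltW y0) ?(ltW Xa) // divfK // gt_eqF.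
rewrite -mulrA ler_pM ?powR_ge0 ?mulr_ge0 ?powR_ge0 //.
  by apply: powR_between => //; rewrite ?ler_pdivlMr ?ler_pdivrMr.
pose u := X `^ (S / 2) * m; pose v := X `^ (al * r - S / 2).
have -> : X `^ (al * r) * m = u * v.
  rewrite /u /v mulrAC -powRD; last by rewrite (gt_eqF X0) implybT.
  by congr (_ `^ _ * _); ring.
have -> : X `^ S * m ^+ 2 = u ^+ 2.
  by rewrite /u exprMn -[(X `^ _) ^+ 2]powR_mulrn ?powR_ge0 // -powRrM divfK.
have -> : X `^ (- (S - al * (j%:R - 2))) = v ^+ 2.
  rewrite /v -powR_mulrn ?powR_ge0 // -powRrM; congr (_ `^ _).
  by rewrite /r; field.
have := sqr_ge0 (u - v); have := sqr_ge0 u; have := sqr_ge0 v; nra.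
Qed.

End Weights.

Section ComplexBounds.
Context {R : realType} {n : nat}.

Lemma parts_le (z : Cx R) (r : R) : `|z| <= ofR r ->
  `|complex.Re z| <= r /\ `|complex.Im z| <= r.
Proof.
case: z => x y; rewrite normc_def lecR /= => zr.
split; apply: le_trans zr; rewrite -sqrtr_sqr ler_wsqrtr //.
  by rewrite lerDl sqr_ge0.
by rewrite lerDr sqr_ge0.
Qed.

Lemma norm_expi (a : R) : `|expi a| = 1 :> Cx R.
Proof. by rewrite normc_def /= cos2Dsin2 sqrtr1. Qed.

Lemma norm_ofR (r : R) : `|ofR r| = ofR `|r|.
Proof. by rewrite normc_def /= expr0n /= addr0 sqrtr_sqr. Qed.

Lemma norm_entry_le (c : 'cV[Cx R]_n) i : `|c i 0| <= ofR (hnorm c).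
Proof.
case E : (c i 0) => [x y]; rewrite normc_def lecR /=.
rewrite ler_wsqrtr // (bigD1 i) //= E /= lerDl sumr_ge0 // => j _.
by rewrite addr_ge0 // sqr_ge0.
Qed.

Lemma line_proj_entry (v : 'cV[R]_n) i j : `|line_proj v i j| <= 1.
Proof.
rewrite !mxE big_ord1 !mxE.
have sq l : v l 0 ^+ 2 <= enorm v ^+ 2.
  by rewrite enorm2E (bigD1 l) //= lerDl sumr_ge0 // => m _; exact: sqr_ge0.
have [->|v0] := eqVneq (enorm v ^+ 2) 0; first by rewrite invr0 mul0r normr0.
have vp : 0 < enorm v ^+ 2 by rewrite lt_neqAle eq_sym v0 sqr_ge0.
rewrite normrM normfV (ger0_norm (ltW vp)) mulrC ler_pdivrMr // mul1r.
have := sq i; have := sq j; rewrite normrM -[v i 0 ^+ 2]real_normK ?num_real //.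
rewrite -[v j 0 ^+ 2]real_normK ?num_real //; have := sqr_ge0 (`|v i 0| - `|v j 0|); nra.
Qed.

Lemma mulmx_entry_le (P : 'M[R]_n) (c : 'cV[Cx R]_n) (a K : R) i :
    (forall l m, `|P l m| <= K) ->
  let V := expi a *: (map_mx ofR P *m c) in
  `|complex.Re (V i 0)| <= n%:R * K * hnorm c /\
  `|complex.Im (V i 0)| <= n%:R * K * hnorm c.
Proof.
move=> PK V; apply: parts_le; rewrite !mxE normrM norm_expi mul1r.
apply: le_trans (ler_norm_sum _ _ _) _.
have -> : ofR (n%:R * K * hnorm c) = \sum_(l < n) ofR (K * hnorm c).
  by rewrite sumr_const card_ord -mulrA mulr_natl /ofR rmorphMn.
apply: ler_sum => l _; rewrite normrM mxE norm_ofR /ofR rmorphM /=.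
rewrite ler_pM ?norm_entry_le //; by rewrite lecR.
Qed.

End ComplexBounds.

Section Solution.
Context {R : realType} {n : nat}.
Variables (mu lams delta beta : R) (b : periodic_distribution R n) (x : 'cV[R]_n).

Let l1 (k : 'cV[int]_n) := lambda1 mu lams delta beta (freq k : 'cV[R]_n).
Let l2 (k : 'cV[int]_n) := lambda2 mu delta beta (freq k : 'cV[R]_n).

(** The image under P of the k-th Fourier mode of b, set to zero at k = 0, where
    the solution has its separate polynomial term. *)
Definition mode (P : 'M[R]_n) (k : 'cV[int]_n) : 'cV[Cx R]_n :=
  if k == 0 then 0 else expi (dotv (freq k) x) *: (map_mx ofR P *m b k).

(** On each eigenspace of M_k, with eigenvalue l < 0 and w = sqrt (- l), the
    matrix acts by (cos (w t) - 1) / l = (1 - cos (w t)) / w ^ 2. *)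
Lemma multiplier_osc (t : R) (k : 'cV[int]_n) : k != 0 -> l1 k < 0 -> l2 k < 0 ->
  (cos_sqrt_opp_mult mu lams delta beta t k - 1%:M) *m invmx (mult mu lams delta beta k)
  = osc 0 (Num.sqrt (- l1 k)) t *: line_proj (freq k)
    + osc 0 (Num.sqrt (- l2 k)) t *: (1%:M - line_proj (freq k)).
Proof.
move=> k0 l10 l20.
pose Mf f := mult_fun mu lams delta beta f k.
have oscE l : l < 0 -> osc 0 (Num.sqrt (- l)) t = (cos (Num.sqrt (- l) * t) - 1) * l^-1.
  move=> ln; rewrite /osc (_ : (0 == 0)%:R = 1) // expr0 mul0r addr0.
  rewrite sqr_sqrtr ?oppr_ge0 ?(ltW ln) //.
  by field; rewrite ltr0_neq0.
have invE : invmx (mult mu lams delta beta k) = Mf (fun l => l^-1).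
  have MM : mult mu lams delta beta k *m Mf (fun l => l^-1) = 1%:M.
    rewrite [LHS]mult_funM // /mult_fun !divff ?ltr0_neq0 //.
    by rewrite !scale1r addrC subrK.
  by rewrite -[LHS]mulmx1 -MM mulmxA mulVmx ?mul1mx // mult_unitmx.
have cosE : cos_sqrt_opp_mult mu lams delta beta t k - 1%:M
    = Mf (fun l => cos (Num.sqrt (- l) * t) - 1).
  rewrite /Mf /cos_sqrt_opp_mult /mult_fun !scalerBl !scale1r !scalerBr.
  by rewrite addrACA -opprD addrC [line_proj _ + _]addrC subrK addrC.
by rewrite cosE invE [LHS]mult_funM // /mult_fun !oscE.
Qed.

Lemma map_mx_ofR_lin (r s : R) (P Q : 'M[R]_n) :
  map_mx ofR (r *: P + s *: Q) = ofR r *: map_mx ofR P + ofR s *: map_mx ofR Q.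
Proof. by apply/matrixP => i j; rewrite !mxE /ofR rmorphD !rmorphM. Qed.

Lemma usol_termE (t : R) (k : 'cV[int]_n) : (forall k, k != 0 -> l1 k < 0 /\ l2 k < 0) ->
  usol_term mu lams delta beta b x t k =
  osc_term (fun k => Num.sqrt (- l1 k)) (fun k => Num.sqrt (- l2 k))
    (fun k => mode (line_proj (freq k)) k) (fun k => mode (1%:M - line_proj (freq k)) k) t k.
Proof.
move=> l0; rewrite /usol_term /osc_term /mode; have [->|k0] := eqVneq k 0.
  by rewrite !scaler0 addr0.
have [l10 l20] := l0 k k0.
have scalerC (e r : Cx R) (v : 'cV[Cx R]_n) : e *: (r *: v) = r *: (e *: v).
  by rewrite !scalerA mulrC.
rewrite multiplier_osc // map_mx_ofR_lin mulmxDl scalerDr.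
rewrite -(scalemxAl (ofR (osc _ _ _)) (map_mx ofR (line_proj _))).
rewrite -(scalemxAl (ofR (osc _ _ _)) (map_mx ofR (1%:M - line_proj _))).
by rewrite (scalerC _ (ofR (osc 0 (Num.sqrt (- l1 k)) t)))
  (scalerC _ (ofR (osc 0 (Num.sqrt (- l2 k)) t))).
Qed.

(** The factor 2 bounds the entries of a line projection and of its complement. *)
Definition mode_size (k : 'cV[int]_n) : R := if k == 0 then 0 else n%:R * 2 * hnorm (b k).

Lemma mode_entry_le (P : 'M[R]_n) (k : 'cV[int]_n) i : (forall l m, `|P l m| <= 2) ->
  `|complex.Re (mode P k i 0)| <= mode_size k /\
  `|complex.Im (mode P k i 0)| <= mode_size k.
Proof.
move=> P2; rewrite /mode /mode_size; case: eqP => _; last exact: mulmx_entry_le.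
by rewrite mxE /= normr0.
Qed.

Lemma mode_size_ge0 k : 0 <= mode_size k.
Proof. by rewrite /mode_size; case: eqP => // _; rewrite !mulr_ge0 // sqrtr_ge0. Qed.

Lemma bounded_mode_weights (l : 'cV[int]_n -> R) (c C al S : R) (j : nat) :
    0 < c ->
    (forall k, k != 0 -> let X := (1 + enorm (freq k : 'cV[R]_n) ^+ 2) `^ al in
       c * X <= - l k <= C * X) ->
    sobolev S b -> n%:R <= S - al * (j%:R - 2) ->
  bounded_sums (fun k => Num.sqrt (- l k) ^+ j / Num.sqrt (- l k) ^+ 2 * mode_size k).
Proof.
move=> c0 lP bS qn; pose X k := 1 + enorm (freq k : 'cV[R]_n) ^+ 2.
have C0 : 0 <= c `^ ((j%:R - 2) / 2) + C `^ ((j%:R - 2) / 2) by rewrite addr_ge0 ?powR_ge0.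
apply: le_bounded_sums (bounded_sumsZ C0 (bounded_sumsD
  (bounded_sumsZ (sqr_ge0 (n%:R * 2)) (sobolev_bounded bS)) (bounded_lattice_decay qn))).
move=> k; rewrite {1}/mode_size; case: eqP => [_|/eqP k0].
  rewrite mulr0; apply: mulr_ge0 => //; apply: addr_ge0; last exact: powR_ge0.
  by apply: mulr_ge0; rewrite ?sqr_ge0 // mulr_ge0 ?powR_ge0 ?sqr_ge0.
have /andP[lo hi] := lP k k0.
have X0 : 0 < X k by rewrite ltr_wpDr ?sqr_ge0.
have := weight_le S j c0 X0 (mode_size_ge0 k) lo hi.
rewrite /mode_size (negbTE k0) => /le_trans; apply.
by rewrite ler_wpM2l // lerD2r exprMn mulrCA.
Qed.

End Solution.

Theorem theorem33 (R : realType) (n : nat) (mu lams delta beta S : R)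
    (p : nat) (b : periodic_distribution R n) :
  (1 <= n)%N ->
  0 < delta ->
  n%:R < beta -> beta < n%:R + 2 ->
  0 < mu ->
  (forall nu : 'cV[R]_n, nu != 0 -> lambda1 mu lams delta beta nu < 0) ->
  (forall nu : 'cV[R]_n, nu != 0 -> lambda2 mu delta beta nu < 0) ->
  0 <= S -> sobolev S b ->
  n%:R + (p%:R - 2) * ((beta - n%:R) / 2) < S ->
  forall x : 'cV[R]_n, torus x ->
    (forall t : R, 0 <= t ->
       cvg (usol_sums mu lams delta beta b x t @ summability.totally)) /\
    Cp_halfline p (usol mu lams delta beta b x).
Proof.
move=> n1 d0 nb bn mu0 l10 l20 _ bS pS x _.
have ln k : k != 0 -> lambda1 mu lams delta beta (freq k : 'cV[R]_n) < 0 /\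
    lambda2 mu delta beta (freq k : 'cV[R]_n) < 0.
  by move=> k0; split; [apply: l10|apply: l20]; rewrite freq_eq0.
have [c [C [c0 order]]] := eigenvalue_order n1 d0 mu0 nb bn l10.
pose w1 k := Num.sqrt (- lambda1 mu lams delta beta (freq k : 'cV[R]_n)).
pose w2 k := Num.sqrt (- lambda2 mu delta beta (freq k : 'cV[R]_n)).
pose V1 k := mode b x (line_proj (freq k)) k.
pose V2 k := mode b x (1%:M - line_proj (freq k)) k.
have entry2 (k : 'cV[int]_n) i j :
    `|(1%:M - line_proj (freq k : 'cV[R]_n)) i j| <= 2.
  have := line_proj_entry (freq k : 'cV[R]_n) i j; move: (line_proj _) => P P1.
  rewrite !mxE (le_trans (ler_normB _ _)) // (_ : 2 = 1 + 1) // lerD //.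
  by case: (i == j); rewrite ?normr1 ?normr0.
have entry1 (k : 'cV[int]_n) i j : `|line_proj (freq k : 'cV[R]_n) i j| <= 2.
  by rewrite (le_trans (line_proj_entry _ _ _)) // ler1n.
pose m := mode_size b.
have mV1 k i : `|complex.Re (V1 k i 0)| <= m k /\ `|complex.Im (V1 k i 0)| <= m k.
  exact: mode_entry_le.
have mV2 k i : `|complex.Re (V2 k i 0)| <= m k /\ `|complex.Im (V2 k i 0)| <= m k.
  exact: mode_entry_le.
have bounded j : (j <= p)%N ->
    bounded_sums (fun k => w1 k ^+ j / w1 k ^+ 2 * m k + w2 k ^+ j / w2 k ^+ 2 * m k).
  move=> jp; have jS : n%:R <= S - (beta - n%:R) / 2 * (j%:R - 2).
    have : (beta - n%:R) / 2 * (j%:R - 2) <= (beta - n%:R) / 2 * (p%:R - 2).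
      by rewrite ler_wpM2l ?divr_ge0 ?subr_ge0 ?(ltW nb) // lerD2r ler_nat.
    by rewrite mulrC in pS; lra.
  apply: bounded_sumsD; apply: (bounded_mode_weights c0 _ bS jS) => k k0.
    by have [ord1 _] := order k k0; exact: ord1.
  by have [_ ord2] := order k k0; exact: ord2.
have sumsE t : usol_sums mu lams delta beta b x t
    = summability.partial_sum (osc_term w1 w2 V1 V2 t).
  rewrite /usol_sums; congr summability.partial_sum; apply/funext => k.
  exact: usol_termE.
have w10 k : 0 <= w1 k by exact: sqrtr_ge0.
have w20 k : 0 <= w2 k by exact: sqrtr_ge0.
split.
  move=> t _; rewrite sumsE; apply: cvgP.
  exact: (osc_series_cvg w10 w20 mV1 mV2 bounded).
have := osc_series_Cp (b 0) w10 w20 mV1 mV2 bounded.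
congr (Cp_halfline p _); apply/funext => t.
by rewrite /usol sumsE.
Qed.
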